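(* Let $T>0$, $J=[0,T]$, $q\in(1,2]$, $\alpha\in[0,1]$. Let $K\subset\mathbb{R}^m$ be nonempty, closed and convex, let $F:J\times\mathbb{R}^n\to E^n$ be a fuzzy mapping, and let $g:J\times\mathbb{R}^n\to\mathbb{R}^{n\times m}$, $Q:J\times\mathbb{R}^n\to\mathbb{R}^m$, $S:\mathbb{R}^m\to\mathbb{R}^m$, $c_1,c_2:J\times\mathbb{R}^n\to\mathbb{R}^n$ be continuous. Assume: (A1) there is $L_F>0$ with $\mathcal{H}(F_{(t,z_1)},F_{(t,z_2)})\le L_F\|z_1-z_2\|$ for all $t\in J$, $z_1,z_2\in\mathbb{R}^n$; (A2) for every $z\in\mathbb{R}^n$, $F_{(\cdot,z)}$ is strongly measurable; (A3) there is $p\in L^\infty(J,\mathbb{R}^+)$ such that for every $z\in\mathbb{R}^n$ and a.e. $t\in J$, $\|F_{(t,z)}\|\le p(t)$; (A4) there is $\eta_g>0$ with $\|g(t,z)\|\le\eta_g$ for all $t\in J$, $z\in\mathbb{R}^n$; (A5) there is $\eta_Q>0$ with $\|Q(t,z)\|\le\eta_Q$ for all $t\in J$, $z\in\mathbb{R}^n$; (A6) $S$ is monotone on $K$ and there is $u_0\in K$ with $\displaystyle\liminf_{u\in K,\ \|u\|\to\infty}\frac{\langle S(u),u-u_0\rangle}{\|u\|^2}>0$; (A7) there are $M_1,M_2>0$ with $\|c_1(t,z)\|\le M_1$ and $\|c_2(t,z)\|\le M_2$ for all $t\in J$, $z\in\mathbb{R}^n$; (A8) $\displaystyle\rho=\frac{2L_FT^q}{\Gamma(q+1)}<1$.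 Then the fuzzy fractional differential variational inequality with integral boundary conditions $$\begin{cases}{}^{C}_{0}D_t^q y(t)\in[F_{(t,y(t))}]_\alpha+g(t,y(t))u(t), & \text{a.e. }t\in J,\\ u(t)\in\mathrm{SOL}(K,Q(t,y(t))+S(\cdot)), & \text{a.e. }t\in J,\\ y(0)=\int_0^Tc_1(\tau,y(\tau))\,d\tau,\quad y(T)=\int_0^Tc_2(\tau,y(\tau))\,d\tau\end{cases}$$ has at least one mild solution $(y,u)$, i.e. its solution set is nonempty.
   Context: Notation. $\langle\cdot,\cdot\rangle$ and $\|\cdot\|$ are the Euclidean inner product and norm; on $\mathbb{R}^{n\times m}$, $\|\cdot\|$ is a matrix norm compatible with these ($\|Av\|\le\|A\|\|v\|$). $\Gamma$ is the Gamma function, ${}^{C}_{0}D_t^q$ the Caputo fractional derivative of order $q$. $C(J,\mathbb{R}^n)$ carries the maximum norm $\|y\|_C=\max_{t\in J}\|y(t)\|$. Fuzzy sets. A fuzzy set of $\mathbb{R}^n$ is a map $\omega:\mathbb{R}^n\to[0,1]$; $[\omega]_\alpha=\{x:\omega(x)\ge\alpha\}$ for $\alpha\in(0,1]$ and $[\omega]_0=\overline{\bigcup_{\alpha\in(0,1]}[\omega]_\alpha}$. $E^n$ is the set of fuzzy sets of $\mathbb{R}^n$ that are normal ($\omega(x)=1$ for some $x$), fuzzy convex ($\omega(\lambda x+(1-\lambda)x')\ge\min\{\omega(x),\omega(x')\}$ for $\lambda\in[0,1]$), upper semicontinuous as functions, and have compact level sets (including $[\omega]_0$). A fuzzy mapping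 $F:J\times\mathbb{R}^n\to E^n$ assigns to $(t,z)$ the fuzzy set $F_{(t,z)}$. With $H$ the Hausdorff distance, $\mathcal{H}(\omega_1,\omega_2)=\sup_{0\le\alpha\le1}H([\omega_1]_\alpha,[\omega_2]_\alpha)$, and $\|\omega\|=\mathcal{H}(\omega,\widetilde0)=\sup_{x\in[\omega]_0}\|x\|$, where $\widetilde0(x)=1$ if $x=0$ and $0$ otherwise. $F_{(\cdot,z)}$ is strongly measurable if for every $\alpha\in[0,1]$ the set-valued map $t\mapsto[F_{(t,z)}]_\alpha$ is (Lebesgue) measurable. Variational inequality. For $t\in J$, $z\in\mathbb{R}^n$, $\mathrm{SOL}(K,Q(t,z)+S(\cdot))$ is the set of $u\in K$ with $\langle Q(t,z)+S(u),v-u\rangle\ge0$ for all $v\in K$. (The liminf in (A6) is $+\infty$ by convention if $K$ is bounded.) Mild solution. A pair $(y,u)$ with $y\in C(J,\mathbb{R}^n)$ and $u:J\to K$ integrable is a mild solution if $u(t)\in\mathrm{SOL}(K,Q(t,y(t))+S(\cdot))$ for a.e. $t\in J$ and there is $f\in L^1(J,\mathbb{R}^n)$ with $f(\tau)\in[F_{(\tau,y(\tau))}]_\alpha$ for a.e. $\tau\in J$ such that for all $t\in J$ $$y(t)=\frac1{\Gamma(q)}\int_0^t(t-\tau)^{q-1}[f(\tau)+g(\tau,y(\tau))u(\tau)]\,d\tau-\frac{t}{\Gamma(q)T}\int_0^T(T-\tau)^{q-1}[f(\tau)+g(\tau,y(\tau))u(\tau)]\,d\tau+\frac tT\int_0^Tc_2(\tau,y(\tau))\,d\tau+\Big(1-\frac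 tT\Big)\int_0^Tc_1(\tau,y(\tau))\,d\tau.$$ *)

(* Defs.v *)
From HB Require Import structures.
From mathcomp Require Import all_boot all_order all_algebra.
From mathcomp Require Import all_classical all_reals all_analysis.
From mathcomp Require Import measurable_realfun.

Set Implicit Arguments.
Unset Strict Implicit.
Unset Printing Implicit Defensive.

Import Order.TTheory GRing.Theory Num.Theory.
Import numFieldNormedType.Exports.

Local Open Scope classical_set_scope.
Local Open Scope ring_scope.

(* R^n is 'cV[R]_n.  The library norm `|_| on matrices is the maximum norm, so
   the Euclidean structure is defined here; both norms induce the library
   topology, which is the one meant by closed, compact, continuous, etc. *)
Definition dot (R : realType) (n : nat) (u v : 'cV[R]_n) : R :=
  \sum_(i < n) u i 0 * v i 0.

Definition enorm (R : realType) (n : nat) (u : 'cV[R]_n) : R :=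
  Num.sqrt (dot u u).

Definition compatible_mxnorm (R : realType) (n m : nat)
    (N : 'M[R]_(n, m) -> R) : Prop :=
  [/\ forall A, N A = 0 -> A = 0,
      forall a A, N (a *: A) = `|a| * N A,
      forall A B, N (A + B) <= N A + N B &
      forall A (v : 'cV[R]_m), enorm (A *m v) <= N A * enorm v].

Definition Gamma (R : realType) (q : R) : R :=
  \int[@lebesgue_measure R]_(x in `]0, +oo[) (x `^ (q - 1) * expR (- x)).

(* L^1 and integrals of R^n-valued functions are taken componentwise.  The
   library's lebesgue_measure lives on the Borel sigma-algebra, so integrable
   functions are Borel representatives of their L^1 classes. *)
Definition vintegrable (R : realType) (n : nat) (D : set R)
    (f : R -> 'cV[R]_n) : Prop :=
  forall i, (@lebesgue_measure R).-integrable D (fun x => (f x i 0)%:E).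

Definition vintegral (R : realType) (n : nat) (D : set R)
    (f : R -> 'cV[R]_n) : 'cV[R]_n :=
  \col_i \int[@lebesgue_measure R]_(x in D) (f x i 0).

Definition edist_to (R : realType) (n : nat) (B : set 'cV[R]_n)
    (x : 'cV[R]_n) : \bar R :=
  ereal_inf [set (enorm (x - y))%:E | y in B].

Definition hausdorff (R : realType) (n : nat) (A B : set 'cV[R]_n) : \bar R :=
  Order.max (ereal_sup [set edist_to B x | x in A])
            (ereal_sup [set edist_to A y | y in B]).

Definition fuzzy (R : realType) (n : nat) : Type := 'cV[R]_n -> R.

Definition level (R : realType) (n : nat) (w : fuzzy R n) (a : R) :
    set 'cV[R]_n :=
  if 0 < a then [set x | a <= w x]
  else closure (\bigcup_(b in `]0, 1]) [set x | b <= w x]).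

(* Upper semicontinuity of w is lower semicontinuity of - w. *)
Definition En (R : realType) (n : nat) : set (fuzzy R n) :=
  [set w : fuzzy R n | [/\ forall x, 0 <= w x <= 1,
               exists x, w x = 1,
               forall (l : R) x x', 0 <= l <= 1 ->
                 Num.min (w x) (w x') <= w (l *: x + (1 - l) *: x'),
               lower_semicontinuous (fun x => (- w x)%:E) &
               forall a, 0 <= a <= 1 -> compact (level w a)]].

Definition fuzzy_dist (R : realType) (n : nat) (w1 w2 : fuzzy R n) : \bar R :=
  ereal_sup [set hausdorff (level w1 a) (level w2 a) | a in `[0, 1]].

Definition fuzzy_zero (R : realType) (n : nat) : fuzzy R n :=
  fun x => (x == 0)%:R.

Definition fuzzy_norm (R : realType) (n : nat) (w : fuzzy R n) : \bar R :=
  fuzzy_dist w (@fuzzy_zero R n).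

(* completed_algebra_gen lebesgue_measure is the family of all unions of a
   Borel set and a negligible set, i.e. the Lebesgue sigma-algebra. *)
Definition set_valued_measurable (R : realType) (n : nat) (D : set R)
    (G : R -> set 'cV[R]_n) : Prop :=
  forall O : set 'cV[R]_n, open O ->
    completed_algebra_gen (@lebesgue_measure R)
      (D `&` [set t | G t `&` O !=set0]).

Definition strongly_measurable (R : realType) (n : nat) (D : set R)
    (G : R -> fuzzy R n) : Prop :=
  forall a, 0 <= a <= 1 -> set_valued_measurable D (fun t => level (G t) a).

Definition monotone_on (R : realType) (m : nat) (K : set 'cV[R]_m)
    (S : 'cV[R]_m -> 'cV[R]_m) : Prop :=
  forall u v, K u -> K v -> 0 <= dot (S u - S v) (u - v).

(* u in K, enorm u --> +oo.  If K is bounded this filter contains the empty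
   set, and limf_einf along it is +oo. *)
Definition at_infty_in (R : realType) (m : nat) (K : set 'cV[R]_m) :
    set_system 'cV[R]_m :=
  within K (filter_from [set: R] (fun M => [set u | M < enorm u])).

Definition SOL (R : realType) (m : nat) (K : set 'cV[R]_m)
    (G : 'cV[R]_m -> 'cV[R]_m) : set 'cV[R]_m :=
  [set u | K u /\ forall v, K v -> 0 <= dot (G u) (v - u)].

Definition mild_solution (R : realType) (n m : nat) (T q alpha : R)
    (K : set 'cV[R]_m) (F : R -> 'cV[R]_n -> fuzzy R n)
    (g : R -> 'cV[R]_n -> 'M[R]_(n, m)) (Q : R -> 'cV[R]_n -> 'cV[R]_m)
    (S : 'cV[R]_m -> 'cV[R]_m) (c1 c2 : R -> 'cV[R]_n -> 'cV[R]_n)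
    (y : R -> 'cV[R]_n) (u : R -> 'cV[R]_m) : Prop :=
  [/\ {within `[0, T], continuous y},
      forall t, t \in `[0, T] -> K (u t),
      vintegrable `[0, T] u,
      {ae @lebesgue_measure R, forall t, t \in `[0, T] ->
         SOL K (fun w => Q t (y t) + S w) (u t)} &
      exists f : R -> 'cV[R]_n,
        [/\ vintegrable `[0, T] f,
            {ae @lebesgue_measure R, forall t, t \in `[0, T] ->
               level (F t (y t)) alpha (f t)} &
            let h s := f s + g s (y s) *m u s in
            let I t := vintegral `[0, t] (fun s => (t - s) `^ (q - 1) *: h s) in
            forall t, t \in `[0, T] ->
              y t = (Gamma q)^-1 *: I t
                    - (t / (Gamma q * T)) *: I T
                    + (t / T) *: vintegral `[0, T] (fun s => c2 s (y s))
                    + (1 - t / T) *: vintegral `[0, T] (fun s => c1 s (y s))]].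

(* Main.v *)
Require Import Defs.
From HB Require Import structures.
From mathcomp Require Import all_boot all_order all_algebra.
From mathcomp Require Import perm.
From mathcomp Require Import all_classical all_reals all_analysis.
From mathcomp Require Import measurable_realfun ess_sup_inf.
From mathcomp Require Import zify ring lra.

Set Implicit Arguments.
Unset Strict Implicit.
Unset Printing Implicit Defensive.

Import Order.TTheory GRing.Theory Num.Theory.
Import numFieldNormedType.Exports.

Local Open Scope classical_set_scope.
Local Open Scope ring_scope.

(** The growth condition makes the solutions of the variational inequality
    bounded, and the minimal-norm element f(t,z) of the level set of F(t,z) is
    measurable in t, continuous in z and bounded, so F can be replaced by f.
    On a grid with N cells, seek the values of the state and of the control on
    the cells: the equation for y and the inequality for u, written as a
    projection equation, are a finite-dimensional fixed-point problem solved by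
    Brouwer's theorem.  The states obtained are bounded and equicontinuous and
    converge uniformly along a subsequence.  The controls u_j converge only
    weakly, but suitable convex combinations of their tails converge almost
    everywhere.  For monotone S, membership in SOL(K, w + S) is equivalent to the
    inequalities <w + S v, v - u> >= 0 for all v in K, which are affine in u, and
    the integral equation is affine in u as well; hence both survive convex
    combinations and pass to the limit.

    Brouwer's theorem is obtained from a cubical labelling lemma, proved with the
    sum of the determinants det (1 | w(v_0), ..., w(v_n)) over the simplices of
    Kuhn's triangulation: it only depends on the boundary values of w, and it
    vanishes if no simplex takes both labels in every coordinate. *)

(** * A degree argument on the integer grid *)

(** Since [S] is only monotone, the inequality may have many solutions and u cannot be eliminated as
    a function of the state; this is why states and controls are unknowns of one finite-dimensional
    problem. The projection equation needs a bounded set. So [K] is cut off at radius C + 1, where C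
    bounds the solutions of every truncated problem of radius at least C; a solution strictly inside
    the ball solves the original inequality. The minimal-norm element need not be Lipschitz in z
    although the level sets are. Its coordinates are read off from the gradient at 0 of the squared
    distance to the level set, and distances are Lipschitz in z and measurable in t. Since q > 1,
    the kernel (t - s)^(q - 1) is bounded and Hoelder continuous in t, which makes the approximate
    states equicontinuous. *)

Lemma det_const_col (F : comNzRingType) (n : nat) (A : 'M[F]_n) (c1 c2 : 'I_n)
    (a : F) :
  c1 != c2 -> (forall l, A l c1 = 1) -> (forall l, A l c2 = a) -> \det A = 0.
Proof.
move=> c12 A1 A2.
pose B := \matrix_(i, j) (if j == c2 then 1 else A i j).
have -> : \det A = a * \det B.
  rewrite (expand_det_col A c2) (expand_det_col B c2) mulr_sumr.
  apply: eq_bigr => l _; rewrite A2 mxE eqxx mul1r /cofactor;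
    congr (_ * (_ * \det _)).
  by apply/matrixP => i j; rewrite !mxE eq_sym (negbTE (neq_lift _ _)).
rewrite -[\det B]det_tr (determinant_alternate c12) ?mulr0// => l.
by rewrite !mxE eqxx (negbTE c12) A1.
Qed.

Section grid_simplices.
Variables (n' k' : nat).
Let n := n'.+1.
Let k := k'.+1.
Let pt := 'I_n -> nat.

(* The simplices of the Kuhn triangulation of the cube [x, x + 1] are the
   increasing paths x = v_0, ..., v_n in which the step number [rho j] is taken in
   direction [j]. *)
Definition vert (x : pt) (rho : 'S_n) (l : nat) : pt :=
  fun j => (x j + (rho j < l))%N.

Definition corner (x : {ffun 'I_n -> 'I_k}) : pt := fun j => x j.

(** The shift is cyclic in direction [j0], hence a bijection of the set of cubes along which sums
    can be reindexed. *)
Definition shift_corner (j0 : 'I_n) (x : {ffun 'I_n -> 'I_k}) :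
    {ffun 'I_n -> 'I_k} :=
  [ffun j => if j == j0 then ordS (x j) else x j].

Lemma shift_corner_inj j0 : injective (shift_corner j0).
Proof.
move=> x y /ffunP xy; apply/ffunP => j; have := xy j; rewrite !ffunE.
by case: eqP => // _; apply: ordS_inj.
Qed.

Definition boundary_face (V : 'I_n -> pt) :=
  exists j, (forall r, V r j = 0%N) \/ (forall r, V r j = k).

(** When direction [j0] is taken last, the first n vertices have the same coordinate [j0]. The
    cyclic shift matches the translate of such a face with the corresponding face of the next cube;
    the pair produced by the wrap-around consists of two boundary faces, where [h] vanishes. *)
Lemma sum_shift (h : ('I_n -> pt) -> rat) (rho : 'S_n) (j0 : 'I_n) :
  (forall V, boundary_face V -> h V = 0) ->
  rho j0 = ord_max ->
  \sum_x h (fun r => vert (corner x) rho r) =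
  \sum_x h (fun r j => vert (corner x) rho r j + (j == j0))%N.
Proof.
move=> h0 rj0; rewrite (reindex_inj (@shift_corner_inj j0)) /=.
apply: eq_bigr => x _.
have vj0 r y : vert y rho (r : 'I_n) j0 = y j0.
  by rewrite /vert rj0 /= ltnNge -ltnS ltn_ord addn0.
have [xk|xk] := eqVneq (x j0 : nat) k'.
  rewrite !h0//; exists j0; [right|left] => r.
    by rewrite vj0 /corner xk eqxx addn1.
  by rewrite vj0 /corner ffunE eqxx /= xk modnn.
congr h; apply/funext => r; apply/funext => j; rewrite /vert /corner ffunE.
have [->|_] := eqVneq j j0; last by rewrite addn0.
rewrite /= modn_small; first by rewrite addn1 addSn.
by rewrite ltnS ltn_neqAle xk -ltnS ltn_ord.
Qed.

(** The face opposite an inner vertex does not see the order of the two steps around that vertex;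
    exchanging them flips the sign, so these terms cancel within a cube. The faces opposite the
    first and the last vertex cancel between neighbouring cubes, by [sum_shift]. *)
Lemma sum_faces0 (h : ('I_n -> pt) -> rat) :
  (forall V, boundary_face V -> h V = 0) ->
  \sum_x \sum_(rho : 'S_n) (-1) ^+ rho *
    \sum_(l < n.+1) (-1) ^+ l * h (fun r => vert (corner x) rho (lift l r)) = 0.
Proof.
move=> h0.
rewrite (eq_bigr (fun x => \sum_(l < n.+1) \sum_(rho : 'S_n) (-1) ^+ rho *
    ((-1) ^+ l * h (fun r => vert (corner x) rho (lift l r))))); last first.
  move=> x _; rewrite exchange_big; apply: eq_bigr => rho _.
  by rewrite mulr_sumr.
rewrite exchange_big /= big_ord_recl big_ord_recr /=.
rewrite [X in _ + (X + _)]big1 => [|l _]; last first.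
  apply: big1 => x _; set S := (X in X = 0).
  suff SN : S = - S by apply/eqP;
    rewrite -[_ == _](mulrn_eq0 S 2) mulr2n {1}SN addNr.
  pose p : 'I_n := widen_ord (leqnSn _) l; pose p1 : 'I_n := lift ord0 l.
  have pp1 : p != p1 by apply/eqP => /(congr1 val) /=; rewrite /bump /=; lia.
  rewrite {1}/S (reindex_inj (mulIg (tperm p p1))) /= /S -sumrN.
  apply: eq_bigr => rho _; rewrite odd_permM odd_tperm pp1 addbT.
  rewrite signrN mulNr; congr (- (_ * (_ * h _))).
  apply/funext => r; apply/funext => j; rewrite /vert permM.
  case: tpermP => [->|->|//]; congr (_ + nat_of_bool _)%N => /=;
    rewrite /bump /=; case: ltngtP; lia.
rewrite add0r.
rewrite exchange_big [X in _ + X]exchange_big -big_split /=.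
(* [c] moves the last step to the front. The face opposite [v_0] for [rho * c] is the face opposite
   [v_n] for [rho], translated by one unit in direction [j0]; the sign (-1)^n' of [c] is opposite to
   the sign (-1)^n of the latter face. *)
pose c : 'S_n := lift_perm ord_max ord0 1%g.
rewrite big_split /= (reindex_inj (mulIg c)) -big_split /=.
apply: big1 => rho _.
pose j0 := (rho^-1)%g ord_max.
have rj0 : rho j0 = ord_max by rewrite permKV.
have -> : \sum_x (-1) ^+ (rho * c)%g *
    (1 * h (fun r => vert (corner x) (rho * c)%g (lift ord0 r))) =
   \sum_x (-1) ^+ rho * ((-1) ^+ n' *
     h (fun r j => vert (corner x) rho r j + (j == j0))%N).
  apply: eq_bigr => x _; rewrite odd_permM odd_lift_perm odd_perm1 /= !addbF.
  rewrite signr_addb signr_odd mul1r mulrA; congr (_ * h _).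
  apply/funext => r; apply/funext => j; rewrite /vert permM -addnA; congr addn.
  have [->|jj0] := eqVneq j j0.
    rewrite rj0 lift_perm_id /= /bump /=; have := ltn_ord r; rewrite /n; lia.
  case: (unliftP ord_max (rho j)) => [i|] ri.
    rewrite ri lift_perm_lift perm1 /= /bump /=.
    have il : (i < n')%N := ltn_ord i.
    by rewrite [(n' <= i)%N]leqNgt il /= !addn0 add0n !add1n ltnS.
  by move: jj0; rewrite /j0 -ri permK eqxx.
rewrite -!mulr_sumr -(sum_shift h0 rj0).
have -> : \sum_x h (fun r : 'I_n => vert (corner x) rho (bump (bump 0 n') r)) =
    \sum_x h (fun r => vert (corner x) rho r).
  apply: eq_bigr => x _; congr h; apply/funext => r; congr vert.
  by rewrite /bump /= add1n leqNgt ltn_ord.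
by rewrite -mulrDr -mulrDl [bump 0 n']add1n exprS mulN1r subrr mul0r mulr0.
Qed.

Definition simplex_mx (w : 'I_n -> pt -> rat) (x : pt) (rho : 'S_n) :
    'M[rat]_n.+1 :=
  \matrix_(l, c) if unlift ord0 c is Some j then w j (vert x rho l) else 1.

(** Up to the factor n!, this is the sum of the signed volumes of the images of the simplices under
    the piecewise affine extension of [w]. *)
Definition degree (w : 'I_n -> pt -> rat) : rat :=
  \sum_x \sum_(rho : 'S_n) (-1) ^+ rho * \det (simplex_mx w (corner x) rho).

(* Expand along the column of the slot [i] where [w] and [w'] differ.  Since the
   cofactors of that column add up to 0, the value at the vertex [l] can be
   replaced by minus the sum over the opposite face, so that the l-th term depends
   on that face only; interior faces cancel in pairs and boundary faces vanish. *)
Lemma degree_slot (w w' : 'I_n -> pt -> rat) (i : 'I_n) :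
  (forall j, j != i -> w j = w' j) ->
  (forall x, x i = 0%N \/ x i = k -> w i x = w' i x) ->
  (forall j, j != i -> exists a b, (forall x, x j = 0%N -> w j x = a) /\
                          (forall x, x j = k -> w j x = b)) ->
  degree w = degree w'.
Proof.
move=> ww' bd cst; apply/eqP; rewrite -subr_eq0 /degree -sumrB.
pose c := lift ord0 i.
pose d v : rat := w i v - w' i v.
pose B (V : 'I_n -> pt) : 'M[rat]_n := \matrix_(r, c')
  (if unlift ord0 (lift c c') is Some j then w j (V r) else 1).
pose h (V : 'I_n -> pt) : rat := (\sum_r d (V r)) * ((-1) ^+ c * \det (B V)).
have h0 V : boundary_face V -> h V = 0.
  case=> j; rewrite /h; have [->|ji] := eqVneq j i.
    move=> Vi; rewrite big1 ?mul0r// => r _; apply/eqP; rewrite subr_eq0.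
    by apply/eqP/bd; case: Vi => ->; [left|right].
  move=> Vj.
  (* On a wall in direction [j], the column of [w j] in [B] is constant and stands beside a column
     of ones. *)
  have [a Ha] : exists a, forall r, w j (V r) = a.
    have [a [b [wa wb]]] := cst _ ji.
    by case: Vj => Vj; [exists a|exists b] => r; [apply: wa|apply: wb].
  have c0 : c != ord0 by rewrite eq_sym neq_lift.
  have cj : c != lift ord0 j by rewrite (inj_eq (@lift_inj _ _)) eq_sym.
  case: (unlift_some c0) => c0' Ec0 _; case: (unlift_some cj) => cj' Ecj _.
  rewrite (@det_const_col _ _ (B V) c0' cj' a) ?mulr0 //.
  - by apply/eqP => E; have := neq_lift ord0 j; rewrite Ecj Ec0 E eqxx.
  - by move=> l; rewrite mxE -Ec0 unlift_none.
  - by move=> l; rewrite mxE -Ecj liftK.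
apply/eqP; rewrite -[RHS]oppr0 -[in RHS](sum_faces0 h0) -sumrN.
apply: eq_bigr => x _; rewrite -sumrB -sumrN; apply: eq_bigr => rho _.
rewrite -mulrBr -mulrN; congr (_ * _).
set A := simplex_mx w _ _; set A' := simplex_mx w' _ _.
have cofE l : cofactor A' l c = cofactor A l c.
  rewrite /cofactor; congr (_ * \det _); apply/matrixP => r c'; rewrite !mxE.
  case: unliftP => // j E; rewrite ww'//; apply/eqP => ji.
  by have := neq_lift c c'; rewrite E ji eqxx.
rewrite (expand_det_col A c) (expand_det_col A' c) -sumrB.
have cof0 : \sum_l cofactor A l c = 0.
  pose A1 := \matrix_(l, c') if c' == c then 1 else A l c'.
  have := @det_const_col _ _ A1 ord0 c 1.
  rewrite (expand_det_col A1 c) => H.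
  rewrite -[RHS]H ?neq_lift//.
  - apply: eq_bigr => l _; rewrite mxE eqxx mul1r /cofactor; congr (_ * \det _).
    apply/matrixP => r c'; rewrite !mxE.
    by rewrite [_ == c]eq_sym (negbTE (neq_lift c c')).
  - by move=> l; rewrite !mxE unlift_none; case: (_ == _).
  - by move=> l; rewrite mxE eqxx.
pose D := \sum_(l < n.+1) d (vert (corner x) rho l).
have -> : - (\sum_(l < n.+1) (-1) ^+ l * h (fun r =>
  vert (corner x) rho (lift l r)))
   = \sum_(l < n.+1) (d (vert (corner x) rho l) - D) * cofactor A l c.
  rewrite -sumrN; apply: eq_bigr => l _.
  have -> : D = d (vert (corner x) rho l) +
      \sum_r d (vert (corner x) rho (lift l r)).
    rewrite /D (bigD1 l) //=; congr (_ + _).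
    rewrite (reindex_onto (lift l) (fun i => odflt ord0 (unlift l i))) /=.
      by apply: eq_bigl => r; rewrite liftK eq_sym neq_lift eqxx.
    by move=> r rl; case: unliftP rl => [j ->//|->]; rewrite eqxx.
  rewrite opprD addNKr mulNr /h; congr (- _); rewrite mulrCA; congr (_ * _).
  rewrite /cofactor exprD -mulrA; congr (_ * (_ * \det _)).
  by apply/matrixP => r c'; rewrite !mxE.
under [RHS]eq_bigr do rewrite mulrBl.
rewrite [RHS]sumrB -mulr_sumr cof0 mulr0 subr0; apply: eq_bigr => l _.
by rewrite cofE -mulrBl !mxE liftK.
Qed.

Definition top_ind (j : 'I_n) (x : pt) : rat := (x j == k)%:R.

(** Only the cube at the top corner contributes: in any other cube some indicator column vanishes.
    There each matrix is a triangular matrix of ones with its columns permuted by [rho], so every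
    signed determinant is 1 and the sum is n!. *)
Lemma degree_top_ind : degree top_ind != 0.
Proof.
rewrite /degree (bigD1 [ffun=> ord_max]) //= addrC big1 => [|x xk]; last first.
  have [j xj] : exists j, x j != ord_max.
    apply/existsP; rewrite -negb_forall; apply: contra xk => /forallP xk.
    by apply/eqP/ffunP => j; rewrite ffunE; apply/eqP.
  apply: big1 => rho _; rewrite (expand_det_col _ (lift ord0 j)) big1 ?mulr0//.
  move=> l _; rewrite mxE liftK /top_ind /vert /corner.
  rewrite (_ : _ == _ = false) ?mul0r//; apply/eqP => E.
  move/eqP: xj; apply; apply/ord_inj => /=; move: E (ltn_ord (x j)).
  case: (_ < _)%N => /=; first by rewrite addn1 => -[].
  by rewrite addn0 => ->; rewrite ltnn.
rewrite add0r (eq_bigr (fun=> 1)) => [|rho _]; last first.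
  pose tri : 'M[rat]_n.+1 := \matrix_(l, c) (c <= l)%:R.
  pose s : 'S_n.+1 := lift_perm ord0 ord0 rho.
  have -> : simplex_mx top_ind (corner [ffun=> ord_max]) rho = col_perm s tri.
    apply/matrixP => l c; rewrite !mxE; case: unliftP => [j ->|->].
      rewrite lift_perm_lift /top_ind /vert /corner ffunE /=.
      by rewrite -[X in _ == X](addn1 k') eqn_add2l eqb1 /bump.
    by rewrite lift_perm_id.
  rewrite col_permE det_mulmx det_perm odd_permV odd_lift_perm /= mulrCA.
  rewrite -signr_addb addbb mulr1 det_trig.
    by rewrite big1 // => l _; rewrite mxE leqnn.
  by apply/is_trig_mxP => l c lc; rewrite mxE leqNgt lc.
by rewrite sumr_const card_Sn pnatr_eq0 -lt0n fact_gt0.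
Qed.

(** The slots of [lab] are exchanged for [top_ind] one at a time; both agree on the two walls of
    their direction, so the degree stays nonzero and some simplex has a nonzero determinant. A label
    constant on that simplex would give a constant column beside the column of ones. *)
Lemma kuhn_labelling (lab : 'I_n -> pt -> bool) :
  (forall i x, x i = 0%N -> lab i x = false) ->
  (forall i x, x i = k -> lab i x = true) ->
  exists x : 'I_n -> 'I_k, forall i, exists p q : pt,
    [/\ forall j, (x j <= p j <= (x j).+1)%N,
        forall j, (x j <= q j <= (x j).+1)%N,
        lab i p = false & lab i q = true].
Proof.
move=> lab0 labk.
pose W s (i : 'I_n) (v : pt) : rat :=
  if (i < s)%N then top_ind i v else (lab i v)%:R.
have W0 s i v : v i = 0%N -> W s i v = 0.
  by move=> v0; rewrite /W /top_ind v0 lab0//; case: ifP.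
have Wk s i v : v i = k -> W s i v = 1.
  by move=> vk; rewrite /W /top_ind vk labk// eqxx; case: ifP.
have Dstep s : (s < n)%N -> degree (W s) = degree (W s.+1).
  move=> sn; apply: (@degree_slot _ _ (Ordinal sn)).
  - move=> j js; apply/funext => v; rewrite /W ltnS.
    suff /negbTE js' : (j : nat) != s by rewrite [(j <= s)%N]leq_eqVlt js'.
    by apply/eqP => E; move/eqP: js; apply; apply/ord_inj.
  - by move=> v [v0|vk]; [rewrite !W0|rewrite !Wk].
  - by move=> j _; exists 0, 1; split=> v; [apply: W0|apply: Wk].
have D0 : degree (W 0%N) = degree top_ind.
  have -> : top_ind = W n.
    by apply/funext => i; apply/funext => v; rewrite /W ltn_ord.
  suff H s : (s <= n)%N -> degree (W 0%N) = degree (W s) by apply: H.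
  by elim: s => // s IH sn; rewrite IH 1?ltnW // Dstep.
have [x [rho]] : exists x : {ffun 'I_n -> 'I_k}, exists rho : 'S_n,
    \det (simplex_mx (W 0%N) (corner x) rho) != 0.
  apply/not_existsP => H; have := degree_top_ind; rewrite -D0 => /eqP; apply.
  apply: big1 => x _; apply: big1 => rho _.
  have [->|/eqP d0] := eqVneq (\det (simplex_mx (W 0%N) (corner x) rho)) 0.
    by rewrite mulr0.
  by exfalso; apply: (H x); exists rho; apply/eqP.
move=> detN0; exists x => i.
have H b : exists p : pt,
    (forall j, (x j <= p j <= (x j).+1)%N) /\ lab i p = b.
  apply/not_existsP => Hp; move/eqP: detN0; apply.
  apply: (@det_const_col _ _ _ ord0 (lift ord0 i) (~~ b)%:R).
  - exact: neq_lift.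
  - by move=> l; rewrite mxE unlift_none.
  - move=> l; rewrite mxE liftK /W /=.
    have [labb|] := eqVneq (lab i (vert (corner x) rho l)) b.
      exfalso; apply: (Hp (vert (corner x) rho l)); split => // j.
      by rewrite /vert /corner leq_addr /= -[(x j).+1]addn1 leq_add2l leq_b1.
    by case: (lab _ _); case: b {Hp}.
have [p [xp lp]] := H false; have [q [xq lq]] := H true.
by exists p, q.
Qed.

End grid_simplices.

(** * Limits along ultrafilters and Brouwer's theorem *)

Lemma cvg_ultra (R : realType) (U : set_system nat) (x : nat -> R) (B : R) :
  UltraFilter U -> (forall k, `|x k| <= B) -> exists l : R, x @ U --> l.
Proof.
move=> UU xB.
have /(_ (x @ U)) : compact `[- B, B]%classic by exact: segment_compact.
case=> [|l [_ Hl]].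
  by apply: nearW => k /=; rewrite in_itv /= -ler_norml.
exists l => A nA.
have [//|UnA] := in_ultra_setVsetC (x @^-1` A) UU.
by have [y [nAy Ay]] := Hl (~` A) A UnA nA.
Qed.

(** Every bounded real sequence converges along an ultrafilter, so limits for all coordinates, and
    later for all times, are obtained at once without diagonal extraction. The tails in [U] let
    indices be chosen arbitrarily large. *)
Lemma free_ultrafilter :
  exists U : set_system nat, UltraFilter U /\ forall m, U [set k | (m <= k)%N].
Proof.
have [U [UU sU]] := ultraFilterLemma eventually_filter.
by exists U; split=> // m; apply: sU; exists m.
Qed.

Lemma cvg_invSn (R : realType) (C : R) : (fun n => C / n.+1%:R) @ \oo --> 0.
Proof.
rewrite -[X in _ --> X](mulr0 C); apply: cvgM; first exact: cvg_cst.
exact: cvg_harmonic.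
Qed.

Lemma cvg_dist_invSn (R : realType) (V : normedModType R) (x : nat -> V) (l : V)
    (C : R) :
  (forall m, `|l - x m| <= C / m.+1%:R) -> x @ \oo --> l.
Proof.
move=> H; apply/cvgrPdist_le => e e0.
have /cvgrPdist_le /(_ e e0) := cvg_invSn C.
apply: filterS => n; rewrite sub0r normrN => Hn.
exact: le_trans (H n) (le_trans (ler_norm _) Hn).
Qed.

(** [kappa] need not be increasing: [m <= kappa m] and the explicit rate are enough for the limits
    taken below. *)
Lemma bounded_subseq (R : realType) (I : finType) (u : nat -> I -> R) (B : R) :
  (forall k i, `|u k i| <= B) ->
  exists (kappa : nat -> nat) (l : I -> R), (forall m, (m <= kappa m)%N) /\
    forall i m, `|l i - u (kappa m) i| <= m.+1%:R^-1.
Proof.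
move=> uB; have [U [UU Um]] := free_ultrafilter.
have /choice[l Hl] : forall i, exists l : R, (fun k => u k i) @ U --> l.
  by move=> i; apply: (cvg_ultra UU) => k; apply: uB.
have H m : exists k, (m <= k)%N /\ forall i, `|l i - u k i| <= m.+1%:R^-1.
  apply: (@filter_ex _ U); apply: filterI; first exact: Um.
  apply: filter_forall => i; have /cvgrPdist_le/(_ m.+1%:R^-1) := Hl i.
  by rewrite invr_gt0 ltr0n => /(_ isT).
have [kappa Hk] := choice H.
by exists kappa, l; split => [m|i m]; have [] := Hk m.
Qed.

Section brouwer.
Variables (R : realType) (I : finType) (B : R) (f : (I -> R) -> I -> R).
Hypothesis B0 : 0 < B.
Hypothesis fB : forall x, (forall i, `|x i| <= B) -> forall i, `|f x i| <= B.

(** A node of a grid on the box is labelled, in each coordinate, by the direction in which [f] moves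
    it. The constant 2 B / (k + 1) is the mesh of the grid, hence the distance within one cube. *)
Lemma opposite_displacements (k : nat) : exists c : I -> R,
  (forall i, `|c i| <= B) /\
  forall i, exists p q : I -> R,
    [/\ forall j, `|p j| <= B, forall j, `|q j| <= B,
        forall j, `|c j - p j| <= 2 * B / k.+1%:R,
        forall j, `|c j - q j| <= 2 * B / k.+1%:R &
        p i <= f p i /\ f q i <= q i].
Proof.
have [I0|] := posnP #|I|.
  by exists (fun=> 0); split=> [i|i]; have := card0_eq I0 i; rewrite inE.
case nI : #|I| => [//|n'] _.
pose rk (i : I) : 'I_n'.+1 := cast_ord nI (enum_rank i).
pose ik (j : 'I_n'.+1) : I := enum_val (cast_ord (esym nI) j).
have rkK : cancel rk ik by move=> i; rewrite /ik /rk cast_ordK enum_rankK.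
have ikK : cancel ik rk by move=> i; rewrite /ik /rk enum_valK cast_ordKV.
have k0 : 0 < k.+1%:R :> R by rewrite ltr0n.
pose node (x : 'I_n'.+1 -> nat) (i : I) : R :=
  - B + 2 * B * (x (rk i))%:R / k.+1%:R.
have nodeB x : (forall j, (x j <= k.+1)%N) -> forall i, `|node x i| <= B.
  move=> xk i; rewrite ler_norml /node; apply/andP; split.
    by rewrite lerDl mulr_ge0 ?invr_ge0 ?ler0n// mulr_ge0 ?ler0n// mulr_ge0// ltW.
  suff: (x (rk i))%:R / k.+1%:R <= 1 :> R.
    rewrite -[2 * B * _ / _]mulrA; move: (_ / _) => t t1.
    rewrite -subr_ge0 (_ : _ - _ = 2 * B * (1 - t)); last by ring.
    by rewrite mulr_ge0 ?subr_ge0// mulr_ge0// ltW.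
  by rewrite ler_pdivrMr// mul1r ler_nat.
(* The labels on the walls are forced. They remain truthful about the displacement because [f] maps
   the box to itself: it cannot decrease a coordinate equal to -B nor increase one equal to B. *)
pose lab (j : 'I_n'.+1) x := (x j != 0%N) &&
  ((k < x j)%N || (f (node x) (ik j) <= node x (ik j))).
have [||x Hx] := @kuhn_labelling n' k lab.
- by move=> i x xi; rewrite /lab xi.
- by move=> i x xi; rewrite /lab xi /= ltnS leqnn.
have near_node p : (forall j, (x j <= p j <= (x j).+1)%N) ->
    forall j, `|node x j - node p j| <= 2 * B / k.+1%:R.
  move=> xp j; rewrite /node opprD addrACA subrr add0r -mulrBl -mulrBr.
  rewrite !normrM (ger0_norm (ltW B0)) normfV !normr_nat.
  rewrite ler_pM2r ?invr_gt0// ler_piMr ?mulr_ge0 ?(ltW B0)//.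
  have /andP[x1 x2] := xp (rk j).
  by rewrite distrC -natrB// normr_nat lern1 leq_subLR addn1.
have box p : (forall j, (x j <= p j <= (x j).+1)%N) -> forall j, (p j <= k.+1)%N.
  by move=> xp j; have /andP[_ pj] := xp j; apply: leq_trans pj _; rewrite ltn_ord.
exists (node x); split.
  by apply: nodeB => j; rewrite ltnW.
move=> i; have [p [q [xp xq]]] := Hx (rk i).
rewrite /lab rkK => lp lq; exists (node p), (node q); split.
- exact/nodeB/box.
- exact/nodeB/box.
- exact: near_node.
- exact: near_node.
split.
- have := fB (nodeB _ (box _ xp)) i; rewrite ler_norml => /andP[fp _].
  move: lp; have [p0 _|_ /=] := eqVneq (p (rk i)) 0%N.
    by rewrite {1}/node p0 mulr0 mul0r addr0.
  by move/norP => [_]; rewrite -ltNge => /ltW.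
- have := fB (nodeB _ (box _ xq)) i; rewrite ler_norml => /andP[_ fq].
  case/andP: lq => _ /orP[kq|//].
  have qk : q (rk i) = k.+1 by apply/eqP; rewrite eqn_leq kq box.
  by apply: le_trans fq _; rewrite /node qk mulfK ?gt_eqF//; lra.
Qed.

(** The points [p] and [q] depend on the coordinate [i] and on the mesh, but as the mesh shrinks
    they all converge to the same [l]; the two opposite inequalities become an equality there. *)
Lemma brouwer :
  (forall (u : nat -> I -> R) l, (forall k i, `|u k i| <= B) ->
     (forall i, (fun k => u k i) @ \oo --> l i) ->
     forall i, (fun k => f (u k) i) @ \oo --> f l i) ->
  exists x, (forall i, `|x i| <= B) /\ forall i, f x i = x i.
Proof.
move=> fcont; have [c Hc] := choice opposite_displacements.
have cB k i : `|c k i| <= B by have [] := Hc k.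
have [kappa [l [kam lc]]] := bounded_subseq cB.
have close (w : nat -> I -> R) :
    (forall m j, `|c (kappa m) j - w m j| <= 2 * B / (kappa m).+1%:R) ->
    forall i, (fun m => w m i) @ \oo --> l i.
  move=> cw i; apply: (@cvg_dist_invSn _ _ _ _ (1 + 2 * B)) => m.
  rewrite -(subrKA (c (kappa m) i)) (le_trans (ler_normD _ _))// mulrDl mul1r.
  rewrite lerD ?lc// (le_trans (cw m i))// ler_wpM2l ?mulr_ge0 ?(ltW B0)//.
  by rewrite lef_pV2 ?posrE ?ltr0n// ler_nat ltnS.
have lB i : `|l i| <= B.
  have H : (fun m => c (kappa m) i) @ \oo --> l i.
    by apply: (close (fun m => c (kappa m))) => m j;
      rewrite subrr normr0 divr_ge0 ?mulr_ge0 ?(ltW B0).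
  apply: (ler_cvg_to (cvg_norm H) (cvg_cst B)); exact: nearW.
exists l; split=> // i; apply/eqP; rewrite eq_le.
have /choice[pq Hpq] : forall m, exists pq : (I -> R) * (I -> R),
    [/\ forall j, `|pq.1 j| <= B, forall j, `|pq.2 j| <= B,
        forall j, `|c (kappa m) j - pq.1 j| <= 2 * B / (kappa m).+1%:R,
        forall j, `|c (kappa m) j - pq.2 j| <= 2 * B / (kappa m).+1%:R &
        pq.1 i <= f pq.1 i /\ f pq.2 i <= pq.2 i].
  move=> m; have [_ /(_ i) [p [q H]]] := Hc (kappa m).
  by exists (p, q).
have cp j : (fun m => (pq m).1 j) @ \oo --> l j.
  by apply: (close (fun m => (pq m).1)) => m {}j; have [] := Hpq m.
have cq j : (fun m => (pq m).2 j) @ \oo --> l j.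
  by apply: (close (fun m => (pq m).2)) => m {}j; have [] := Hpq m.
have fp := fcont (fun m => (pq m).1) l _ cp i.
have fq := fcont (fun m => (pq m).2) l _ cq i.
apply/andP; split.
- apply: (ler_cvg_to (fq _) (cq i)) => [m j|]; first by have [] := Hpq m.
  by apply: nearW => m; have [_ _ _ _ []] := Hpq m.
- apply: (ler_cvg_to (cp i) (fp _)) => [m j|]; first by have [] := Hpq m.
  by apply: nearW => m; have [_ _ _ _ []] := Hpq m.
Qed.

End brouwer.

(** * Euclidean geometry and projections *)

Section euclid.
Variables (R : realType) (n : nat).
Implicit Types (u v w x y : 'cV[R]_n) (a : R).

Lemma dotC u v : dot u v = dot v u.
Proof. by apply: eq_bigr => i _; rewrite mulrC. Qed.

Lemma dotDl u v w : dot (u + v) w = dot u w + dot v w.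
Proof. by rewrite -big_split; apply: eq_bigr => i _; rewrite mxE mulrDl. Qed.

Lemma dotZl a u w : dot (a *: u) w = a * dot u w.
Proof. by rewrite mulr_sumr; apply: eq_bigr => i _; rewrite mxE mulrA. Qed.

Lemma dotNl u w : dot (- u) w = - dot u w.
Proof. by rewrite -scaleN1r dotZl mulN1r. Qed.

Lemma dotDr u v w : dot w (u + v) = dot w u + dot w v.
Proof. by rewrite ![dot w _]dotC dotDl. Qed.

Lemma dotZr a u w : dot w (a *: u) = a * dot w u.
Proof. by rewrite ![dot w _]dotC dotZl. Qed.

Lemma dotNr u w : dot w (- u) = - dot w u.
Proof. by rewrite ![dot w _]dotC dotNl. Qed.

Lemma dotBl u v w : dot (u - v) w = dot u w - dot v w.
Proof. by rewrite dotDl dotNl. Qed.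

Definition dotE := (dotDl, dotDr, dotNl, dotNr, dotZl, dotZr).

Lemma dot_ge0 u : 0 <= dot u u.
Proof. by apply: sumr_ge0 => i _; rewrite -expr2 sqr_ge0. Qed.

Lemma dot_eq0 u : dot u u = 0 -> u = 0.
Proof.
move=> u0; apply/colP => i; rewrite mxE; apply/eqP; rewrite -sqrf_eq0 expr2.
move: u0 => /eqP; rewrite psumr_eq0 => [/allP/(_ i)|j _]; last
  by rewrite -expr2 sqr_ge0.
by rewrite mem_index_enum => /(_ isT).
Qed.

Lemma enorm_ge0 u : 0 <= enorm u.
Proof. exact: sqrtr_ge0. Qed.

Lemma enorm_sqr u : enorm u ^+ 2 = dot u u.
Proof. by rewrite sqr_sqrtr ?dot_ge0. Qed.

Lemma enorm_le u a : 0 <= a -> dot u u <= a ^+ 2 -> enorm u <= a.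
Proof. by move=> a0 ua; rewrite -(ger0_norm a0) -sqrtr_sqr ler_wsqrtr. Qed.

Lemma cauchy_schwarz u v : dot u v <= enorm u * enorm v.
Proof.
have [v0|v0] := eqVneq (dot v v) 0.
  by rewrite (dot_eq0 v0) -[X in dot u X](scale0r u) dotZr mul0r mulr_ge0
    ?enorm_ge0.
have vp : 0 < dot v v by rewrite lt0r v0 dot_ge0.
rewrite (le_trans (ler_norm _))// -ler_sqr ?nnegrE ?mulr_ge0 ?enorm_ge0//.
rewrite exprMn !enorm_sqr real_normK ?num_real//.
have := dot_ge0 (dot v v *: u - dot u v *: v).
rewrite !dotE (dotC v u) => H.
by rewrite -(ler_pM2l vp) -subr_ge0; apply: le_trans H _; rewrite le_eqVlt;
  apply/orP; left; apply/eqP; ring.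
Qed.

Lemma enormD u v : enorm (u + v) <= enorm u + enorm v.
Proof.
apply: enorm_le; rewrite ?addr_ge0 ?enorm_ge0// !dotE (dotC v u) sqrrD !enorm_sqr.
have := cauchy_schwarz u v; lra.
Qed.

Lemma enormZ a u : enorm (a *: u) = `|a| * enorm u.
Proof. by rewrite /enorm dotZl dotZr mulrA -expr2 sqrtrM ?sqr_ge0// sqrtr_sqr. Qed.

Lemma enormN u : enorm (- u) = enorm u.
Proof. by rewrite /enorm dotNl dotNr opprK. Qed.

Lemma enorm_dist u v : enorm (u - v) = enorm (v - u).
Proof. by rewrite -enormN opprB. Qed.

Lemma enorm0 : enorm (0 : 'cV[R]_n) = 0.
Proof. by rewrite -(scale0r 0) enormZ normr0 mul0r. Qed.

Lemma enormB u v : enorm u - enorm v <= enorm (u - v).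
Proof. by rewrite lerBlDr (le_trans _ (enormD _ _))// subrK. Qed.

Lemma enorm_distD w u v : enorm (u - v) <= enorm (u - w) + enorm (w - v).
Proof. by rewrite -(subrKA w u (- v)) enormD. Qed.

Lemma coord_le_enorm u i : `|u i 0| <= enorm u.
Proof.
rewrite -sqrtr_sqr ler_wsqrtr// /dot (bigD1 i)//= -expr2 lerDl.
by apply: sumr_ge0 => j _; rewrite -expr2 sqr_ge0.
Qed.

Lemma cvg_colP (T : Type) (F : set_system T) {FF : Filter F} (f : T -> 'cV[R]_n)
    (l : 'cV[R]_n) :
  f @ F --> l <-> forall i, (fun t => f t i 0) @ F --> l i 0.
Proof.
split=> [fl i|fl].
  exact: (cvg_comp _ _ fl (@coord_continuous R n 1 i 0 l)).
move=> A [P /= lP PA]; rewrite /nbhs /=.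
have H : \forall t \near F, forall i, P i 0 (f t i 0).
  by apply: filter_forall => i; apply: fl; apply: lP.
by apply: filterS H => t Pt; apply: PA => i j; rewrite ord1.
Qed.

Lemma cvg_dot (T : Type) (F : set_system T) {FF : Filter F} (f g : T -> 'cV[R]_n)
    (l l' : 'cV[R]_n) :
  f @ F --> l -> g @ F --> l' -> (fun t => dot (f t) (g t)) @ F --> dot l l'.
Proof.
move=> /cvg_colP fl /cvg_colP gl; apply: cvg_big; first exact: add_continuous.
by move=> i _; apply: cvgM; [exact: fl|exact: gl].
Qed.

Lemma cvg_enorm (T : Type) (F : set_system T) {FF : Filter F} (f : T -> 'cV[R]_n)
    (l : 'cV[R]_n) :
  f @ F --> l -> (fun t => enorm (f t)) @ F --> enorm l.
Proof.
move=> fl; rewrite /enorm.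
exact: (cvg_comp _ (@Num.sqrt R) (cvg_dot fl fl) (@sqrt_continuous R _)).
Qed.

Lemma continuous_enorm_dist (c : 'cV[R]_n) : continuous (fun y => enorm (c - y)).
Proof.
move=> y; have H : (fun y : 'cV[R]_n => c - y) @ y --> c - y.
  apply: (@cvgB _ _ _ (nbhs y) (nbhs_filter y) (fun=> c) id c y).
    exact: cvg_cst.
  exact: cvg_id.
exact: (cvg_enorm H).
Qed.

Lemma cvg_enorm_dist (f : nat -> 'cV[R]_n) (l : 'cV[R]_n) (e : nat -> R) :
  (forall k, enorm (f k - l) <= e k) -> e @ \oo --> 0 -> f @ \oo --> l.
Proof.
move=> fe e0; apply/cvg_colP => i; apply/cvgrPdist_le => d d0.
move/cvgrPdist_le: e0 => /(_ d d0); apply: filterS => k; rewrite sub0r normrN => ek.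
have := coord_le_enorm (f k - l) i; rewrite !mxE distrC => H.
by rewrite (le_trans H)// (le_trans (fe k))// (le_trans (ler_norm _)).
Qed.

Definition convex_cV (C : set 'cV[R]_n) :=
  forall u v t, C u -> C v -> 0 <= t <= 1 -> C (u + t *: (v - u)).

Definition is_eproj (C : set 'cV[R]_n) x p :=
  C p /\ forall v, C v -> dot (x - p) (v - p) <= 0.

(* The junk value 0 is never taken when C is nonempty, closed and convex. *)
Definition eproj (C : set 'cV[R]_n) x : 'cV[R]_n := xget 0 (is_eproj C x).

Section projection.
Variable C : set 'cV[R]_n.
Hypotheses (C0 : C !=set0) (Ccl : closed C) (Ccv : convex_cV C).

Lemma eprojP x : is_eproj C x (eproj C x).
Proof.
suff [p Hp] : exists p, is_eproj C x p by apply: (xgetI _ Hp).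
pose D := [set enorm (x - c) | c in C].
have Dinf : has_inf D.
  split; first by case: C0 => c Cc; exists (enorm (x - c)); exists c.
  by exists 0 => _ [c _ <-]; apply: enorm_ge0.
have /choice[c Hc] : forall k : nat, exists c, C c /\ enorm (x - c) < inf D +
  k.+1%:R^-1.
  move=> k; have [|_ [c Cc <-] Hc] := @inf_adherent _ D k.+1%:R^-1 _ Dinf.
    by rewrite invr_gt0.
  by exists c.
have cB k i : `|c k i 0| <= enorm x + inf D + 1.
  apply: le_trans (coord_le_enorm _ _) _; have [_ Hk] := Hc k.
  have : k.+1%:R^-1 <= 1 :> R by rewrite invf_le1 ?ler1n.
  have := enormB (c k) x; rewrite enorm_dist.
  move: (k.+1%:R^-1) Hk (enorm _) => r Hk a; lra.
have [kappa [l [kam lc]]] := bounded_subseq cB.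
pose p : 'cV[R]_n := \col_i l i.
have cp : (fun m => c (kappa m)) @ \oo --> p.
  apply/cvg_colP => i; rewrite mxE; apply: (@cvg_dist_invSn _ _ _ _ 1) => m.
  by rewrite mul1r.
have Cp : C p.
  by apply: (closed_cvg C Ccl _ p cp); apply: nearW => m; have [] := Hc (kappa m).
have pmin v : C v -> enorm (x - p) <= enorm (x - v).
  move=> Cv; apply: (@le_trans _ _ (inf D)); last first.
    by apply: ge_inf; [case: Dinf|exists v].
  have H1 : (fun m => enorm (x - c (kappa m))) @ \oo --> enorm (x - p).
    by apply: cvg_enorm; apply: cvgB => //; apply: cvg_cst.
  have H2 : (fun m => inf D + 1 / m.+1%:R) @ \oo --> inf D.
    by rewrite -[X in _ --> X]addr0; apply: cvgD; [exact: cvg_cst|exact: cvg_invSn].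
  apply: (ler_cvg_to H1 H2); apply: nearW => m; have [_ /ltW Hm] := Hc (kappa m).
  rewrite (le_trans Hm)// lerD2l mul1r lef_pV2 ?posrE ?ltr0n// ler_nat ltnS.
  exact: kam.
exists p; split=> // v Cv; apply/ler_addgt0Pr => e e0; rewrite add0r.
have d0 : 0 <= dot (v - p) (v - p) by apply: dot_ge0.
(* This choice satisfies 0 < t <= 1 and t |v - p|^2 <= e, also when v = p. *)
pose t := e / (dot (v - p) (v - p) + e).
have de : 0 < dot (v - p) (v - p) + e by apply: ltr_wpDl.
have t0 : 0 < t by rewrite divr_gt0.
have t1 : t <= 1 by rewrite ler_pdivrMr// mul1r lerDr.
have := pmin _ (Ccv Cp Cv (introT andP (conj (ltW t0) t1))).
rewrite -ler_sqr ?nnegrE ?enorm_ge0// !enorm_sqr opprD addrA.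
move: (x - p) (v - p) @t d0 de t0 t1 => a b t d0 de t0 t1.
rewrite !dotE (dotC b a) => H.
have {}H : t * (2 * dot a b) <= t * (t * dot b b) by lra.
rewrite ler_pM2l// in H.
suff : t * dot b b <= e by lra.
rewrite /t mulrAC ler_pdivrMr// ler_pM2l//; lra.
Qed.

Lemma eproj_in x : C (eproj C x). Proof. by have [] := eprojP x. Qed.

Lemma eproj_dot x v : C v -> dot (x - eproj C x) (v - eproj C x) <= 0.
Proof. by have [_] := eprojP x; apply. Qed.

Lemma eproj_min x v : C v -> enorm (x - eproj C x) <= enorm (x - v).
Proof.
move=> Cv; apply: enorm_le; first exact: enorm_ge0.
have := eproj_dot x Cv; rewrite enorm_sqr; move: (eproj C x) => p.
have := dot_ge0 (v - p).
rewrite !dotE (dotC p x) (dotC v x) (dotC p v); lra.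
Qed.

Lemma eproj_lip x y : enorm (eproj C x - eproj C y) <= enorm (x - y).
Proof.
have := eproj_dot x (eproj_in y); have := eproj_dot y (eproj_in x).
move: (eproj C x) (eproj C y) => p q H1 H2.
have H3 : dot (p - q) (p - q) <= dot (x - y) (p - q).
  by move: H1 H2; rewrite !dotE; lra.
have [->|pq] := eqVneq (enorm (p - q)) 0; first exact: enorm_ge0.
rewrite -(@ler_pM2r _ (enorm (p - q))); last by rewrite lt0r pq enorm_ge0.
by rewrite -expr2 enorm_sqr (le_trans H3)// cauchy_schwarz.
Qed.

Lemma eproj_cvg (xs : nat -> 'cV[R]_n) x : xs @ \oo --> x ->
  (fun k => eproj C (xs k)) @ \oo --> eproj C x.
Proof.
move=> xsx; apply: (@cvg_enorm_dist _ _ (fun k => enorm (xs k - x))).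
  by move=> k; apply: eproj_lip.
rewrite -enorm0 -(subrr x); apply: cvg_enorm; apply: cvgB => //.
exact: cvg_cst.
Qed.

Lemma eproj_fix p : C p -> eproj C p = p.
Proof.
move=> Cp; have := eproj_dot p Cp => H.
apply/eqP; rewrite eq_sym -subr_eq0; apply/eqP/dot_eq0/eqP.
by rewrite eq_le H dot_ge0.
Qed.

Definition sqdist x := enorm (x - eproj C x) ^+ 2.

(* The squared distance is differentiable with gradient 2 (x - eproj x): along a
   coordinate direction the difference quotient differs from it by at most s. *)
Lemma sqdist_quotient x i s : 0 < s ->
  `|(sqdist (x + s *: delta_mx i 0) - sqdist x) / s
     - 2 * (x - eproj C x) i 0| <= s.
Proof.
move=> s0; pose e : 'cV[R]_n := delta_mx i 0.
have dote u : dot u e = u i 0.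
  rewrite /dot (bigD1 i)//= mxE !eqxx mulr1 big1 ?addr0// => j ji.
  by rewrite mxE (negbTE ji) mulr0.
have dee : dot e e = 1 by rewrite dote mxE !eqxx.
rewrite -/e -dote.
set x' := x + s *: e.
have s' := ltW s0.
(* Each squared distance is compared with the one to the projection of the other point. [H1] gives
   the upper bound; [H2] gives the lower one, where [H3], from the projection being 1-Lipschitz,
   exchanges the two projections. *)
have H1 : sqdist x' <= dot (x' - eproj C x) (x' - eproj C x).
  by rewrite /sqdist -enorm_sqr ler_sqr ?nnegrE ?enorm_ge0// eproj_min//;
    apply: eproj_in.
have H2 : sqdist x <= dot (x - eproj C x') (x - eproj C x').
  by rewrite /sqdist -enorm_sqr ler_sqr ?nnegrE ?enorm_ge0// eproj_min//;
    apply: eproj_in.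
have H3 : dot (eproj C x' - eproj C x) e <= s.
  apply: le_trans (cauchy_schwarz _ _) _.
  rewrite [enorm e]/enorm dee sqrtr1 mulr1 (le_trans (eproj_lip _ _))//.
  by rewrite /x' addrC addKr enormZ /enorm dee sqrtr1 mulr1 gtr0_norm.
move: H1 H2; rewrite {2}/sqdist {1}/sqdist !enorm_sqr.
rewrite -[sqdist x']/(enorm _ ^+ 2) -[sqdist x]/(enorm _ ^+ 2) !enorm_sqr.
move: H3; rewrite /x'; move: (eproj C _) (eproj C x) => q p.
rewrite !dotE dee (dotC e x) (dotC e p) (dotC e q) (dotC p x) (dotC q x).
move: (dot x x) (dot x p) (dot x q) (dot p p) (dot q q) (dot x e) (dot p e)
  (dot q e).
move=> xx xp xq pp qq xe pe qe H3 H1 H2.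
rewrite ler_norml; apply/andP; split.
  rewrite lerBrDr ler_pdivlMr//; nra.
rewrite lerBlDr ler_pdivrMr//; nra.
Qed.

Lemma sqdist_quotient0 i s : 0 < s ->
  `|(sqdist (s *: delta_mx i 0) - sqdist 0) / s + 2 * (eproj C 0) i 0| <= s.
Proof.
by move=> s0; have := sqdist_quotient 0 i s0; rewrite add0r !mxE sub0r mulrN opprK.
Qed.

End projection.
End euclid.

(** * Bounded measurable functions on [0, T] *)

Section bounded_measurable.
Variables (R : realType) (T : R).
Hypothesis T0 : 0 < T.
Implicit Types (f g : R -> R) (a B : R).

Local Notation mu := (@lebesgue_measure R).
Local Notation J := (`[0, T]%classic : set R).

Definition bounded_by f B := forall t, J t -> `|f t| <= B.

Definition bmeas f := measurable_fun J f /\ exists B, bounded_by f B.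

Definition intJ f : R := \int[mu]_(x in J) f x.

Lemma measurableJ : measurable J.
Proof. exact: measurable_itv. Qed.

Lemma mu_J : mu J = T%:E.
Proof. by rewrite lebesgue_measure_itv /= lte_fin T0 sube0. Qed.

Lemma bmeas_cst a : bmeas (fun=> a).
Proof. by split; [exact: measurable_cst|exists `|a|]. Qed.

Lemma bmeasD f g : bmeas f -> bmeas g -> bmeas (fun t => f t + g t).
Proof.
move=> [mf [B fB]] [mg [C gC]]; split; first exact: measurable_funD.
exists (B + C) => t Jt; apply: le_trans (ler_normD _ _) _.
by rewrite lerD ?fB ?gC.
Qed.

Lemma bmeasM f g : bmeas f -> bmeas g -> bmeas (fun t => f t * g t).
Proof.
move=> [mf [B fB]] [mg [C gC]]; split; first exact: measurable_funM.
exists (B * C) => t Jt; rewrite normrM.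
by rewrite ler_pM ?fB ?gC.
Qed.

Lemma bmeasZ a f : bmeas f -> bmeas (fun t => a * f t).
Proof. exact/bmeasM/bmeas_cst. Qed.

Lemma bmeas_eq f g : (forall t, J t -> f t = g t) -> bmeas f -> bmeas g.
Proof.
move=> fg [mf [B fB]]; split.
  by apply: eq_measurable_fun mf => t /set_mem Jt; apply: fg.
by exists B => t Jt; rewrite -fg// fB.
Qed.

Lemma bmeasB f g : bmeas f -> bmeas g -> bmeas (fun t => f t - g t).
Proof.
move=> bf bg; apply: bmeas_eq (bmeasD bf (bmeasZ (-1) bg)) => t _.
by rewrite mulN1r.
Qed.

Lemma bmeas_sum (I : Type) (r : seq I) (F : I -> R -> R) :
  (forall i, bmeas (F i)) -> bmeas (fun t => \sum_(i <- r) F i t).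
Proof.
move=> bF; elim: r => [|i r IH].
  by apply: bmeas_eq (bmeas_cst 0) => t _; rewrite big_nil.
by apply: bmeas_eq (bmeasD (bF i) IH) => t _; rewrite big_cons.
Qed.

Lemma bmeas_step (I : finType) (idx : R -> I) (F : I -> R -> R) :
  (forall j, measurable_fun J (fun s => (idx s == j)%:R : R)) ->
  (forall j, bmeas (F j)) -> bmeas (fun s => F (idx s) s).
Proof.
move=> midx bF; apply: (@bmeas_eq (fun s => \sum_j (idx s == j)%:R * F j s)).
  move=> s _; rewrite (bigD1 (idx s))//= eqxx mul1r big1 ?addr0// => j ji.
  by rewrite eq_sym (negbTE ji) mul0r.
apply: bmeas_sum => j; apply: bmeasM => //; split; first exact: midx.
by exists 1 => s _; case: (_ == _); rewrite ?normr1 ?normr0.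
Qed.

Lemma bmeas_norm f : bmeas f -> bmeas (fun t => `|f t|).
Proof.
move=> [mf [B fB]]; split; first by apply: measurableT_comp.
by exists B => t Jt; rewrite normr_id fB.
Qed.

Lemma bmeas_integrable f : bmeas f -> mu.-integrable J (EFin \o f).
Proof.
move=> [mf [B fB]]; apply: measurable_bounded_integrable => //.
- by rewrite [ltLHS]mu_J ltry.
- exists B; split; first exact: num_real.
  by move=> M BM t Jt; apply: le_trans (fB t Jt) _; apply: ltW.
Qed.

Lemma eq_intJ f g : (forall t, J t -> f t = g t) -> intJ f = intJ g.
Proof. by move=> fg; apply: eq_Rintegral => t /set_mem; apply: fg. Qed.

Lemma intJD f g : bmeas f -> bmeas g ->
  intJ (fun t => f t + g t) = intJ f + intJ g.
Proof.
move=> bf bg; apply: RintegralD; first exact: measurableJ.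
  exact: bmeas_integrable.
exact: bmeas_integrable.
Qed.

Lemma intJZ a f : bmeas f -> intJ (fun t => a * f t) = a * intJ f.
Proof.
move=> bf; apply: RintegralZl; first exact: measurableJ.
exact: bmeas_integrable.
Qed.

Lemma intJB f g : bmeas f -> bmeas g ->
  intJ (fun t => f t - g t) = intJ f - intJ g.
Proof.
move=> bf bg; apply: RintegralB; first exact: measurableJ.
  exact: bmeas_integrable.
exact: bmeas_integrable.
Qed.

Lemma intJ_cst a : intJ (fun=> a) = a * T.
Proof.
rewrite /intJ Rintegral_cst; last exact: measurableJ.
by congr (_ * _); rewrite [X in fine X]mu_J.
Qed.

Lemma intJ_le f g : bmeas f -> bmeas g -> (forall t, J t -> f t <= g t) ->
  intJ f <= intJ g.
Proof.
move=> bf bg fg; rewrite /intJ.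
by apply: (le_Rintegral _ (bmeas_integrable bf) (bmeas_integrable bg) fg).
Qed.

Lemma intJ_bound f B : bmeas f -> bounded_by f B -> `|intJ f| <= B * T.
Proof.
move=> bf fB; rewrite ler_norml -mulNr -!intJ_cst.
apply/andP; split; apply: intJ_le => //; try exact: bmeas_cst.
  by move=> t /fB; rewrite ler_norml => /andP[].
by move=> t /fB; rewrite ler_norml => /andP[].
Qed.

Lemma bmeas_cvg (F : nat -> R -> R) f B :
  (forall k, bmeas (F k)) -> (forall k, bounded_by (F k) B) ->
  (forall t, J t -> (fun k => F k t) @ \oo --> f t) ->
  bmeas f /\ bounded_by f B.
Proof.
move=> bF FB Ff; have fB : bounded_by f B.
  move=> t Jt; apply: (ler_cvg_to (cvg_norm (Ff t Jt)) (cvg_cst B)).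
  by apply: nearW => k; apply: FB.
split=> //; split; last by exists B.
by apply: measurable_fun_cvg Ff => k; have [] := bF k.
Qed.

Lemma intJ_cvg (F : nat -> R -> R) f B :
  (forall k, bmeas (F k)) -> (forall k, bounded_by (F k) B) ->
  {ae mu, forall t, J t -> (fun k => F k t) @ \oo --> f t} -> bmeas f ->
  (fun k => intJ (F k)) @ \oo --> intJ f.
Proof.
move=> bF FB Ff bf.
have bi := bmeas_integrable bf.
have [|||||_ _ H] := @dominated_convergence _ _ R mu J measurableJ
  (fun k => EFin \o F k) (EFin \o f) (EFin \o cst B).
- by move=> k; have /integrableP[] := bmeas_integrable (bF k).
- by have /integrableP[] := bi.
- apply: (@filterS _ _ (ae_filter_ringOfSetsType mu) _ _ _ Ff) => t Ft Jt.
  by apply: cvg_EFin; [exact: nearW|exact: Ft].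
- exact/bmeas_integrable/bmeas_cst.
- by apply: aeW => t k Jt /=; rewrite lee_fin FB.
rewrite /intJ /Rintegral; apply: fine_cvg.
rewrite fineK //.
by apply: integrable_fin_num => //; exact: measurableJ.
Qed.

End bounded_measurable.

(** * Almost everywhere convergence of convex combinations *)

Section mazur.
Variables (R : realType) (T : R).
Hypothesis T0 : 0 < T.

Local Notation mu := (@lebesgue_measure R).
Local Notation J := (`[0, T]%classic : set R).

Lemma sum_expr_half (C : R) n : 0 <= C ->
  \sum_(0 <= k < n) C / 2 ^+ k <= 2 * C.
Proof.
move=> C0.
suff -> : \sum_(0 <= k < n) C / 2 ^+ k = 2 * C - 2 * C / 2 ^+ n.
  by rewrite gerBl divr_ge0 ?mulr_ge0// exprn_ge0.
elim: n => [|n IH]; first by rewrite big_geq// expr0 divr1 subrr.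
rewrite big_nat_recr//= IH exprS.
by field; rewrite expf_eq0 pnatr_eq0 andbF.
Qed.

(** The sum [G] of the increments has a finite integral, so it is finite almost everywhere; at such
    points the telescoping series converges absolutely. *)
Lemma ae_cvg_of_summable (f : nat -> R -> R) (C : R) :
  (forall k, bmeas T (f k)) ->
  (forall k, intJ T (fun t => `|f k.+1 t - f k t|) <= C / 2 ^+ k) ->
  {ae mu, forall t, J t -> cvgn (fun k => f k t)}.
Proof.
move=> bf fC.
pose h k t := `|f k.+1 t - f k t|.
have bh k : bmeas T (h k) by apply/bmeas_norm/bmeasB.
have C0 : 0 <= C.
  have := fC 0%N; rewrite expr0 divr1; apply: le_trans.
  by apply: Rintegral_ge0.
have mh k : measurable_fun J (EFin \o h k).
  by have /integrableP[] := bmeas_integrable T0 (bh k).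
have H0 k t : J t -> (0 <= (EFin \o h k) t)%E.
  by move=> _; rewrite /= lee_fin; apply: normr_ge0.
pose G t := (\sum_(0 <= k <oo) (EFin \o h k) t)%E.
have iG : mu.-integrable J G.
  apply/integrableP; split.
    by apply: (@ge0_emeasurable_sum _ _ _ J (fun k => EFin \o h k) xpredT) =>
      [k t Jt _|k _]; [apply: H0|apply: mh].
  under eq_integral => t _.
    rewrite gee0_abs; last first.
      by apply: nneseries_ge0 => k _ _; rewrite lee_fin; apply: normr_ge0.
    over.
  rewrite integral_nneseries//.
  apply: (@le_lt_trans _ _ (2 * C)%:E); last exact: ltry.
  apply: lime_le.
    by apply: is_cvg_nneseries => k _ _; apply: integral_ge0 => t; apply: H0.
  apply: nearW => n.
  apply: (@le_trans _ _ (\sum_(0 <= k < n) C / 2 ^+ k)%:E); last first.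
    by rewrite lee_fin sum_expr_half.
  rewrite -sumEFin; apply: lee_sum => k _.
  rewrite -(fineK (integrable_fin_num _ (bmeas_integrable T0 (bh k)))) //.
  by rewrite lee_fin; apply: fC.
have aeG : {ae mu, forall t, J t -> G t \is a fin_num}.
  by apply: integrable_ae iG; exact: measurable_itv.
apply: (@filterS _ _ (ae_filter_ringOfSetsType mu) _ _ _ aeG) => t Gt Jt.
have {}Gt := Gt Jt.
have h0 k : 0 <= h k t by rewrite /h.
suff : cvgn (series (telescope (fun k => f k t))).
  move=> cv; rewrite (_ : (fun k => f k t) =
    (fun n => f 0%N t + series (telescope (fun k => f k t)) n)).
    by apply: is_cvgD => //; exact: is_cvg_cst.
  by apply/funext => n; exact: (eq_sum_telescope (fun k => f k t) n).
apply: normed_cvg; apply: nondecreasing_is_cvgn.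
  by apply: nondecreasing_series => k _ _; apply: normr_ge0.
exists (fine (G t)) => _ [n _ <-].
rewrite -lee_fin fineK// /series /= -sumEFin.
rewrite (eq_bigr (fun k => (EFin \o h k) t)) //.
by apply: nneseries_lim_ge => k _ _; rewrite lee_fin; apply: normr_ge0.
Qed.

Variables (m : nat).
Implicit Types (u : nat -> R -> 'cV[R]_m) (v w : R -> 'cV[R]_m).

Definition vbmeas v := forall i, bmeas T (fun t => v t i 0).

Definition midpoint v w : R -> 'cV[R]_m := fun t => 2^-1 *: (v t + w t).

Definition midpoint_closed (A : set (R -> 'cV[R]_m)) :=
  forall v w, A v -> A w -> A (midpoint v w).

(* The convex hull of the tail (u_j), j >= k, defined impredicatively by the
   midpoint-closed properties it inherits. *)
Definition tail_hull u k v :=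
  forall A, midpoint_closed A -> (forall j, (k <= j)%N -> A (u j)) -> A v.

Lemma tail_hull_mid u k : midpoint_closed (tail_hull u k).
Proof. by move=> v w Hv Hw A Am Au; apply: (Am);
  [exact: Hv Am Au|exact: Hw Am Au]. Qed.

Lemma tail_hull_le u k l v : (k <= l)%N -> tail_hull u l v -> tail_hull u k v.
Proof.
move=> kl Hv A Am Au; apply: (Hv A Am) => j lj.
exact: Au (leq_trans kl lj).
Qed.

Definition energy v := intJ T (fun t => dot (v t) (v t)).

Lemma bmeas_dot v w : vbmeas v -> vbmeas w -> bmeas T (fun t => dot (v t) (w t)).
Proof. by move=> bv bw; apply: bmeas_sum => i; apply: bmeasM. Qed.

Lemma vbmeasD v w : vbmeas v -> vbmeas w -> vbmeas (fun t => v t + w t).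
Proof.
by move=> bv bw i; apply: bmeas_eq (bmeasD (bv i) (bw i)) => t _; rewrite mxE.
Qed.

Lemma vbmeasZ a v : vbmeas v -> vbmeas (fun t => a *: v t).
Proof. by move=> bv i; apply: bmeas_eq (bmeasZ a (bv i)) => t _; rewrite mxE. Qed.

Lemma vbmeasB v w : vbmeas v -> vbmeas w -> vbmeas (fun t => v t - w t).
Proof.
by move=> bv bw i; apply: bmeas_eq (bmeasB (bv i) (bw i)) => t _; rewrite !mxE.
Qed.

Lemma parallelogram v w : vbmeas v -> vbmeas w ->
  energy (fun t => v t - w t) =
  2 * (energy v + energy w) - 4 * energy (midpoint v w).
Proof.
move=> bv bw; rewrite /energy -intJD ?(bmeas_dot bv bv, bmeas_dot bw bw)//;
  try exact: bmeas_dot.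
have bm : vbmeas (midpoint v w) by apply/vbmeasZ/vbmeasD.
rewrite -!intJZ//; try (by apply: bmeasD; apply: bmeas_dot);
  try exact: bmeas_dot.
rewrite -intJB//; try (by apply/bmeasZ/bmeas_dot);
  try (by apply/bmeasZ/bmeasD; apply: bmeas_dot).
apply: eq_intJ => t _; rewrite /midpoint !dotE (dotC (w t) (v t)).
by field.
Qed.

Lemma energy_ge0 v : 0 <= energy v.
Proof. by apply: Rintegral_ge0 => t _; apply: dot_ge0. Qed.

(* Near-minimizers of the energy over the decreasing tail hulls form a fast
   Cauchy sequence in L^2 by the parallelogram identity. *)
Lemma mazur_ae u (B : R) :
  (forall k, vbmeas (u k)) ->
  (forall k i, bounded_by T (fun t => u k t i 0) B) ->
  exists (v : nat -> R -> 'cV[R]_m) (w : R -> 'cV[R]_m) (N : set R),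
    [/\ forall k, tail_hull u k (v k), measurable N, mu N = 0 &
      forall t, J t -> ~ N t -> (fun k => v k t) @ \oo --> w t].
Proof.
move=> bu uB.
have hull_ok k v : tail_hull u k v ->
    vbmeas v /\ forall i, bounded_by T (fun t => v t i 0) B.
  move=> Hv; apply: (Hv (fun v => vbmeas v /\
      forall i, bounded_by T (fun t => v t i 0) B)) => [a b [ba aB] [bb bB]|//].
  split; first exact/vbmeasZ/vbmeasD.
  move=> i t Jt; rewrite !mxE normrM normfV normr_nat ler_pdivrMl//.
  by rewrite (le_trans (ler_normD _ _))// mulrDl mul1r lerD ?aB ?bB.
have energyB k v : tail_hull u k v -> energy v <= m%:R * (B * B) * T.
  move=> /hull_ok[bv vB]; apply: le_trans (ler_norm _) _.
  apply: intJ_bound => //; first exact: bmeas_dot.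
  move=> t Jt; apply: le_trans (ler_norm_sum _ _ _) _.
  rewrite mulr_natl -[X in _ *+ X]card_ord -sumr_const; apply: ler_sum => i _.
  by rewrite normrM ler_pM ?(vB i t Jt).
pose E k := [set energy v | v in tail_hull u k].
have Einf k : has_inf (E k).
  split; last by exists 0 => _ [v _ <-]; apply: energy_ge0.
  by exists (energy (u k)), (u k) => // A _ Au; apply: Au.
pose d k := inf (E k).
have dB k : d k <= m%:R * (B * B) * T.
  have [[e [v Hv _]] lE] := Einf k.
  by apply: le_trans (energyB k v Hv); apply: ge_inf => //; exists v.
have Dsup : has_sup (range d).
  by split; [exists (d 0%N), 0%N|exists (m%:R * (B * B) * T) => _ [k _ <-]].
pose D := sup (range d).
(* By the parallelogram identity the step from [v j] to [v j.+1] has energy at most 2 (2 D +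
   [delta j.+1] + [delta j]) - 4 (D - [delta j]), which is at most 8 [delta j], that is 4^-j. *)
pose delta j : R := (4 ^+ j)^-1 / 8.
have delta0 j : 0 < delta j by rewrite divr_gt0// invr_gt0 exprn_gt0.
have d_mono k l : (k <= l)%N -> d k <= d l.
  move=> kl; apply: lb_le_inf; first by case: (Einf l).
  move=> _ [v Hv <-]; apply: ge_inf; first by case: (Einf k).
  by exists v => //; apply: tail_hull_le Hv.
have /choice[Kv HKv] : forall j, exists Kv : nat * (R -> 'cV[R]_m),
    [/\ (j <= Kv.1)%N, D - delta j < d Kv.1, tail_hull u Kv.1 Kv.2 &
       energy Kv.2 < D + delta j].
  move=> j; have [_ [k _ <-] Hk] := sup_adherent (delta0 j) Dsup.
  pose K := maxn j k.
  have [_ [v Hv <-] Ev] := inf_adherent (delta0 j) (Einf K).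
  exists (K, v); split => //=; first exact: leq_maxl.
    by apply: lt_le_trans Hk _; apply: d_mono; apply: leq_maxr.
  by apply: lt_le_trans Ev _; rewrite lerD2r; apply: ub_le_sup;
    [case: Dsup|exists K].
pose v j := (Kv j).2.
have bv j : vbmeas (v j) by have [_ _ /hull_ok[]] := HKv j.
have step j : energy (fun t => v j.+1 t - v j t) <= (4 ^+ j)^-1.
  have [_ D1 H1 E1] := HKv j; have [_ D2 H2 E2] := HKv j.+1.
  have dd : delta j.+1 <= delta j.
    rewrite /delta ler_pM2r// lef_pV2 ?posrE ?exprn_gt0//.
    by rewrite exprS ler_peMl ?exprn_ge0// ler1n.
  have : D - delta j < energy (midpoint (v j.+1) (v j)).
    (* The midpoint is only known to lie in the hull of the earlier of the two tails. *)
    pose K := minn (Kv j).1 (Kv j.+1).1.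
    have HK : D - delta j < d K.
      by rewrite /K /minn; case: ifP => _ //; lra.
    apply: lt_le_trans HK _; apply: ge_inf; first by case: (Einf K).
    exists (midpoint (v j.+1) (v j)) => //.
    by apply: tail_hull_mid; [apply: tail_hull_le H2|apply: tail_hull_le H1];
      rewrite ?geq_minr ?geq_minl.
  rewrite parallelogram// /v; move: dd; rewrite [X in _ <= X]/delta => dd.
  move: E1 E2; rewrite /delta in dd *; lra.
have cv i : {ae mu, forall t, J t -> cvgn (fun k => v k t i 0)}.
  (* The constant comes from |a| <= (2^k a^2 + 2^-k) / 2 after integration, the integral of a^2
     being at most 4^-k. *)
  apply: (@ae_cvg_of_summable _ ((1 + T) / 2)) => [k|k]; first exact: bv.
  set a := fun t => v k.+1 t i 0 - v k t i 0.
  have ba : bmeas T a by apply: bmeasB; apply: bv.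
  have two0 : 0 < 2 ^+ k :> R by rewrite exprn_gt0.
  apply: (@le_trans _ _ (intJ T (fun t =>
    2^-1 * (2 ^+ k * (a t * a t) + (2 ^+ k)^-1)))).
    apply: intJ_le => //.
    - exact: bmeas_norm.
    - by apply/bmeasZ/bmeasD; [apply/bmeasZ/bmeasM|exact: bmeas_cst].
    move=> t _; have -> : a t * a t = `|a t| * `|a t|.
      by rewrite -normrM ger0_norm// -expr2 sqr_ge0.
    move: two0 `|a t| => {ba}; move: (2 ^+ k) => s s0 x.
    have : 0 <= s^-1 * (s * x - 1) ^+ 2 by rewrite mulr_ge0 ?sqr_ge0 ?invr_ge0 ?ltW.
    have -> : s^-1 * (s * x - 1) ^+ 2 = s * (x * x) - 2 * x + s^-1.
      by field; rewrite gt_eqF.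
    lra.
  rewrite intJZ//; last by apply: bmeasD; [apply/bmeasZ/bmeasM|exact: bmeas_cst].
  rewrite intJD//; [|by apply/bmeasZ/bmeasM|exact: bmeas_cst].
  rewrite intJZ//; last exact: bmeasM.
  rewrite intJ_cst//.
  have : intJ T (fun t => a t * a t) <= (4 ^+ k)^-1.
    apply: le_trans _ (step k); apply: intJ_le => //; first exact: bmeasM.
      by apply: bmeas_dot; apply: vbmeasB.
    move=> t _; rewrite /a /dot (bigD1 i)//= !mxE lerDl.
    by apply: sumr_ge0 => j _; rewrite -expr2 sqr_ge0.
  rewrite (_ : (4 ^+ k)^-1 = (2 ^+ k)^-1 * (2 ^+ k)^-1); last first.
    by rewrite -invfM -exprMn -natrM.
  rewrite -(ler_pM2l two0) mulVKf ?gt_eqF//; nra.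
have : {ae mu, forall t, forall i, J t -> cvgn (fun k => v k t i 0)}.
  by apply: (@filter_forall _ _ _ _ (ae_filter_ringOfSetsType mu)); exact: cv.
move=> [N [mN N0 sN]].
exists v, (fun t => \col_i lim ((fun k => v k t i 0) @ \oo)), N; split => //.
  by move=> k; have [kK _ Hk _] := HKv k; apply: tail_hull_le Hk.
move=> t Jt Nt; apply/cvg_colP => i; rewrite mxE.
suff H : forall i, J t -> cvgn (fun k => v k t i 0) by apply: H.
by apply: contrapT => H; apply: Nt; apply: sN.
Qed.

End mazur.

(** * Measurable selections *)

Section borel_modification.
Variables (R : realType) (T : R).
Hypothesis T0 : 0 < T.
Local Notation mu := (@lebesgue_measure R).
Local Notation J := (`[0, T]%classic : set R).

Lemma negligible_bigcup_count (I : countType) (F : I -> set R) :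
  (forall i, mu.-negligible (F i)) -> mu.-negligible (\bigcup_i F i).
Proof.
move=> negF.
pose F' k := if unpickle k is Some i then F i else set0.
apply: (@negligibleS _ _ _ mu (\bigcup_k F' k)).
  by move=> t [i _ Fit]; exists (pickle i) => //; rewrite /F' pickleK.
apply: negligible_bigcup => k; rewrite /F'; case: unpickle => [i|];
  first exact: negF.
exact: negligible_set0.
Qed.

(* The level sets of phi are only Lebesgue measurable: phi becomes Borel measurable
   once it is killed on a Borel null set, here common to countably many phi. *)
Lemma borel_off_null (I : countType) (phi : I -> R -> R) (Z : set R) :
  mu.-negligible Z ->
  (forall i r, completed_algebra_gen mu (J `&` [set t | phi i t < r])) ->
  exists N : set R, [/\ measurable N, mu N = 0, Z `<=` N &
    forall i, measurable_fun J (fun t => if t \in N then 0 else phi i t)].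
Proof.
move=> negZ Hphi.
have /choice[A HA] : forall iq : I * rat, exists A : set R, measurable A /\
    exists2 M, mu.-negligible M &
      A `|` M = J `&` [set t | phi iq.1 t < ratr iq.2].
  by move=> [i q]; have [A mA [M nM HM]] := Hphi i (ratr q); exists A;
    split=> //; exists M.
pose M iq := (J `&` [set t | phi iq.1 t < ratr iq.2]) `\` A iq.
have negM iq : mu.-negligible (M iq).
  have [_ [M' nM' E]] := HA iq; apply: negligibleS nM'.
  by rewrite /M -E => t [[//|//]].
have [N [mN N0 sN]] := negligibleU negZ (negligible_bigcup_count negM).
exists N; split => //; first by move=> t Zt; apply: sN; left.
move=> i; pose psi := (fun t => if t \in N then 0 else phi i t).
rewrite -/psi; apply: (measurability _ (RGenInftyO.measurableE R)).
move=> _ [_ [r ->] <-].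
have -> : J `&` psi @^-1` `]-oo, r[%classic =
    (J `&` (N `&` [set _ | 0 < r])) `|`
    \bigcup_(q in [set q : rat | ratr q < r]) (A (i, q) `\` N).
  apply/seteqP; split=> t /=; rewrite /psi in_itv /=.
    move=> [Jt]; case: ifPn => [/set_mem Nt r0|/negP Nt Hr]; first by left.
    right; have [q] := rat_in_itvoo Hr; rewrite in_itv => /andP[q1 q2].
    exists q => //; split; last by move=> /mem_set.
    apply: contrapT => At; apply: Nt; apply/mem_set; apply: sN; right.
    by exists (i, q).
  move=> [[Jt [Nt r0]]|[q qr [At Nt]]].
    by split=> //; rewrite mem_set.
  have [_ [M' _ E]] := HA (i, q).
  have [Jt Ht] : (J `&` [set t | phi i t < ratr q]) t by rewrite -E; left.
  by split=> //; rewrite memNset//; apply: lt_trans Ht qr.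
apply: measurableU.
  apply: measurableI; first exact: measurable_itv.
  apply: measurableI => //.
  have [r0|r0] := boolP (0 < r); first by rewrite (_ : mkset _ = setT)// -subTset.
  by rewrite (_ : mkset _ = set0)// -subset0.
rewrite bigcup_mkcond; apply: bigcupT_measurable_rat => q; case: ifP => // _.
by apply: measurableD => //; have [] := HA (i, q).
Qed.

End borel_modification.

Section selection.
Variables (R : realType) (n : nat).
Implicit Types (C : set 'cV[R]_n) (x y z : 'cV[R]_n).

Lemma edist_to_eproj C x y (d : R) : C !=set0 -> closed C -> convex_cV C ->
  (edist_to C y <= d%:E)%E -> enorm (x - eproj C x) <= enorm (x - y) + d.
Proof.
move=> C0 Ccl Ccv dy; apply/ler_addgt0Pr => e e0.
have : (edist_to C y < (d + e)%:E)%E.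
  by apply: le_lt_trans dy _; rewrite lte_fin ltrDl.
move=> /ereal_inf_lt[_ [c Cc <-]]; rewrite lte_fin => /ltW yc.
rewrite (le_trans (eproj_min C0 Ccl Ccv x Cc))//.
by rewrite (le_trans (enorm_distD y _ _))// -addrA lerD2l.
Qed.

(** Distances to a fixed point, unlike projections, depend on the set in a Lipschitz way; continuity
    of the selection is recovered from them. *)
Lemma hausdorff_eproj C1 C2 x (d : R) :
  C1 !=set0 -> closed C1 -> convex_cV C1 ->
  C2 !=set0 -> closed C2 -> convex_cV C2 ->
  (hausdorff C1 C2 <= d%:E)%E ->
  `|enorm (x - eproj C1 x) - enorm (x - eproj C2 x)| <= d.
Proof.
move=> C10 C1cl C1cv C20 C2cl C2cv; rewrite /hausdorff ge_max => /andP[H1 H2].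
rewrite ler_distlC; apply/andP; split; rewrite ?lerBlDr.
  apply: edist_to_eproj => //; apply: le_trans H2; apply: ereal_sup_ubound.
  by exists (eproj C2 x) => //; apply: eproj_in.
apply: edist_to_eproj => //; apply: le_trans H1; apply: ereal_sup_ubound.
by exists (eproj C1 x) => //; apply: eproj_in.
Qed.

Variables (T : R) (G : R -> 'cV[R]_n -> set 'cV[R]_n) (L P : R).
Hypothesis T0 : 0 < T.
Local Notation mu := (@lebesgue_measure R).
Local Notation J := (`[0, T]%classic : set R).
Hypotheses (G0 : forall t z, J t -> G t z !=set0)
  (Gcl : forall t z, J t -> closed (G t z))
  (Gcv : forall t z, J t -> convex_cV (G t z))
  (GL : forall t z1 z2, J t ->
     (hausdorff (G t z1) (G t z2) <= (L * enorm (z1 - z2))%:E)%E)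
  (Gm : forall z, set_valued_measurable J (fun t => G t z))
  (GP : forall z, {ae mu, forall t, J t -> forall x, G t z x -> enorm x <= P}).

Let sel t z := eproj (G t z) 0.

Lemma sel_cvg t (zs : nat -> 'cV[R]_n) z : J t -> zs @ \oo --> z ->
  (fun k => sel t (zs k)) @ \oo --> sel t z.
Proof.
move=> Jt zsz; apply/cvg_colP => i; apply/cvgrPdist_le => e e0.
have dist_cvg x : (fun k => sqdist (G t (zs k)) x) @ \oo --> sqdist (G t z) x.
  have H : (fun k => enorm (x - eproj (G t (zs k)) x)) @ \oo -->
      enorm (x - eproj (G t z) x).
    apply/cvgrPdist_le => d d0.
    have : (fun k => L * enorm (z - zs k)) @ \oo --> 0.
      rewrite -[X in _ --> X](mulr0 L); apply: cvgM; first exact: cvg_cst.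
      rewrite -(enorm0 R n) -(subrr z); apply: cvg_enorm.
      by apply: cvgB => //; apply: cvg_cst.
    move=> /cvgrPdist_le/(_ d d0); apply: filterS => k; rewrite sub0r normrN => Hk.
    apply: le_trans (le_trans (ler_norm _) Hk).
    by apply: hausdorff_eproj; try exact: G0; try exact: Gcl; try exact: Gcv;
      apply: GL.
  by rewrite /sqdist; apply: cvgM.
(* Both quotients are within s of -2 times the respective coordinate and eventually within e of each
   other, so the coordinates differ by at most (2 s + e) / 2 = e. *)
pose s := e / 2; have s0 : 0 < s by rewrite divr_gt0.
have qcvg : (fun k => (sqdist (G t (zs k)) (s *: delta_mx i 0) -
     sqdist (G t (zs k)) 0) / s) @ \oo -->
   (sqdist (G t z) (s *: delta_mx i 0) - sqdist (G t z) 0) / s.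
  by apply: cvgM; [apply: cvgB; apply: dist_cvg|exact: cvg_cst].
move/cvgrPdist_le: qcvg => /(_ e e0); apply: filterS => k.
have := sqdist_quotient0 (@G0 _ z Jt) (@Gcl _ z Jt) (@Gcv _ z Jt) i s0.
have := sqdist_quotient0 (@G0 _ (zs k) Jt) (@Gcl _ (zs k) Jt) (@Gcv _ (zs k)
  Jt) i s0.
rewrite -!/(sel _ _).
move: (_ / s) (_ / s) (sel _ _ i 0) (sel _ _ i 0) => a b c d.
rewrite !ler_norml /s => /andP[a1 a2] /andP[b1 b2] /andP[ab1 ab2].
by apply/andP; split; lra.
Qed.

Let zrat (q : {ffun 'I_n -> rat}) : 'cV[R]_n := \col_i ratr (q i).

Lemma zrat_dense z : exists q : nat -> {ffun 'I_n -> rat},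
  (fun k => zrat (q k)) @ \oo --> z.
Proof.
have /choice[q Hq] : forall k : nat, exists q : {ffun 'I_n -> rat}, forall i,
    `|z i 0 - ratr (q i)| <= k.+1%:R^-1.
  move=> k; have /choice[q Hq] : forall i, exists q : rat,
      `|z i 0 - ratr q| <= k.+1%:R^-1.
    move=> i; have [|q] := @rat_in_itvoo R (z i 0) (z i 0 + k.+1%:R^-1).
      by rewrite ltrDl invr_gt0.
    rewrite in_itv => /andP[q1 q2]; exists q.
    by rewrite distrC ger0_norm ?subr_ge0 ?ltW// ltrBlDl.
  by exists [ffun i => q i] => i; rewrite ffunE.
exists q; apply/cvg_colP => i; apply: (@cvg_dist_invSn _ _ _ _ 1) => k.
by rewrite mxE mul1r.
Qed.

(* The coordinates of the minimal-norm element are limits of difference quotients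
   of squared distances to the set (lemma sqdist_quotient0), which are measurable
   in t and continuous in z. *)
Lemma caratheodory_selection :
  exists (f : R -> 'cV[R]_n -> 'cV[R]_n) (N : set R),
    [/\ measurable N /\ mu N = 0,
        forall t z, J t -> ~ N t -> G t z (f t z),
        forall z i, measurable_fun J (fun t => f t z i 0),
        forall t z i, J t -> `|f t z i 0| <= `|P| &
        forall t (zs : nat -> 'cV[R]_n) z, J t -> zs @ \oo --> z ->
          (fun k => f t (zs k)) @ \oo --> f t z].
Proof.
(* Rational states and countably many test points, so that one null set [N] serves all the distances
   and also the bound [P]. Continuity in z then extends measurability and the bound to every z, with
   the same [N]. *)
pose I := ({ffun 'I_n -> rat} * option ('I_n * nat))%type.
pose X (o : option ('I_n * nat)) : 'cV[R]_n :=
  if o is Some (i, k) then k.+1%:R^-1 *: delta_mx i 0 else 0.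
pose phi (a : I) t := enorm (X a.2 - eproj (G t (zrat a.1)) (X a.2)).
have [|a r|N [mN N0 sN mphi]] := @borel_off_null R T I phi
   (\bigcup_(q : {ffun 'I_n -> rat}) ~` [set t | J t ->
     forall x, G t (zrat q) x -> enorm x <= P]).
- by apply: negligible_bigcup_count => q; apply: (GP (zrat q)).
(* The distance from a test point is below r exactly when the set meets the open ball of radius r
   around it, which is what measurability of a set-valued map controls. *)
- have oO : open [set y | enorm (X a.2 - y) < r].
    apply: (@open_comp _ _ (fun y => enorm (X a.2 - y)) [set s | s < r]).
      by move=> y _; exact: continuous_enorm_dist.
    exact: open_lt.
  have := Gm (zrat a.1) oO; congr completed_algebra_gen.
  apply/seteqP; split=> t [Jt] /=; rewrite /phi.
    move=> [y [Gy yr]]; split => //; apply: le_lt_trans yr.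
    by apply: eproj_min => //; [exact: G0|exact: Gcl|exact: Gcv].
  move=> pr; split => //; exists (eproj (G t (zrat a.1)) (X a.2)); split => //.
  by apply: eproj_in; [exact: G0|exact: Gcl|exact: Gcv].
(* The value 0 keeps [f] bounded, and continuous in z, for every t in [J]; only membership in
   [G t z] is given up on [N]. *)
pose f t z := if t \in N then 0 else sel t z.
have fcvg t (zs : nat -> 'cV[R]_n) z : J t -> zs @ \oo --> z ->
    (fun k => f t (zs k)) @ \oo --> f t z.
  by move=> Jt zsz; rewrite /f; case: ifP => _; [exact: cvg_cst|exact: sel_cvg].
have fmq q i : measurable_fun J (fun t => f t (zrat q) i 0).
  pose psi (a : I) t := if t \in N then 0 else phi a t.
  apply: (@measurable_fun_cvg _ _ _ J (fun k t => - 2^-1 *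
    ((psi (q, Some (i, k)) t * psi (q, Some (i, k)) t -
      psi (q, None) t * psi (q, None) t) * k.+1%:R))).
    move=> k; apply: measurable_funM; first exact: measurable_cst.
    apply: measurable_funM; last exact: measurable_cst.
    have mpsi a : measurable_fun J (psi a) := mphi a.
    by apply: measurable_funB; exact: measurable_funM.
  move=> t Jt; rewrite /psi /f; case: (t \in N).
    rewrite mxE (_ : (fun k => _) = fun=> 0); first exact: cvg_cst.
    by apply/funext => k; rewrite mul0r subrr mul0r mulr0.
  apply: (@cvg_dist_invSn _ _ _ _ 1) => k.
  have k0 : 0 < k.+1%:R^-1 :> R by rewrite invr_gt0.
  have := sqdist_quotient0 (@G0 _ (zrat q) Jt) (@Gcl _ (zrat q) Jt) (@Gcv _
    (zrat q) Jt) i k0.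
  rewrite invrK -!expr2 -[sqdist _ (_ *: _)]/(phi (q, Some (i, k)) t ^+ 2).
  rewrite -[sqdist _ 0]/(phi (q, None) t ^+ 2) -/(sel _ _).
  rewrite mul1r; move: (_ * _%:R) (sel _ _ i 0) (_^-1) k0 => a b s s0.
  by rewrite !ler_norml => /andP[a1 a2]; apply/andP; split; lra.
exists f, N; split => //.
- move=> t z Jt Nt; rewrite /f memNset//.
  by apply: eproj_in; [exact: G0|exact: Gcl|exact: Gcv].
- move=> z i; have [q qz] := zrat_dense z.
  apply: (@measurable_fun_cvg _ _ _ J (fun k t => f t (zrat (q k)) i 0)) => // t Jt.
  by have /cvg_colP := fcvg t _ _ Jt qz; apply.
- move=> t z i Jt; have [q qz] := zrat_dense z.
  have /cvg_colP/(_ i) H := fcvg t _ _ Jt qz.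
  apply: (ler_cvg_to (cvg_norm H) (cvg_cst _)); apply: nearW => k.
  rewrite /f; case: ifPn => [_|/negP Nt]; first by rewrite mxE normr0.
  apply: le_trans (coord_le_enorm _ _) _; apply: le_trans (ler_norm P).
  suff : J t -> forall x, G t (zrat (q k)) x -> enorm x <= P.
    by move=> /(_ Jt); apply; apply: eproj_in; [exact: G0|exact: Gcl|exact: Gcv].
  apply: contrapT => H'; apply: Nt; apply/mem_set; apply: sN.
  by exists (q k).
Qed.

End selection.

(** * Level sets and variational inequalities *)

Section levels.
Variables (R : realType) (n : nat).
Implicit Types (w : fuzzy R n) (a : R).

Lemma level_nonempty w a : En w -> 0 <= a <= 1 -> level w a !=set0.
Proof.
move=> [w01 [x wx] _ _ _] /andP[a0 a1]; exists x; rewrite /level.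
case: ifP => _ /=; first by rewrite wx.
by apply: subset_closure; exists 1; rewrite //= ?wx// in_itv /= ltr01 lexx.
Qed.

Lemma level_closed w a : En w -> 0 <= a <= 1 -> closed (level w a).
Proof.
move=> [_ _ _ _ wc] a01; apply: compact_closed; last exact: wc.
exact: norm_hausdorff.
Qed.

Lemma closure_seq (U : set 'cV[R]_n) x :
  closure U x -> exists xs : nat ->
    'cV[R]_n, (forall k, U (xs k)) /\ xs @ \oo --> x.
Proof.
move=> Ux; have /choice[xs Hxs] : forall k : nat, exists y, U y /\ `|x - y| <=
  1 / k.+1%:R.
  move=> k; have [|y [Uy xy]] := Ux (ball x (1 / k.+1%:R)).
    by apply: nbhsx_ballx; rewrite divr_gt0.
  by exists y; split=> //; apply: ltW; move: xy; rewrite -ball_normE.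
exists xs; split=> [k|]; first by have [] := Hxs k.
by apply: (@cvg_dist_invSn _ _ _ _ 1) => k; have [] := Hxs k.
Qed.

Lemma convex_closure (U : set 'cV[R]_n) : convex_cV U -> convex_cV (closure U).
Proof.
move=> Ucv x y t /closure_seq[xs [Uxs xsx]] /closure_seq[ys [Uys ysy]] t01.
have H : (fun k => xs k + t *: (ys k - xs k)) @ \oo --> x + t *: (y - x).
  by apply: cvgD => //; apply: cvgZr; apply: cvgB.
apply: (closed_cvg (closure U) (@closed_closure _ U) _ _ H); apply: nearW => k.
by apply: subset_closure; apply: Ucv.
Qed.

Lemma level_convex w a : En w -> 0 <= a <= 1 -> convex_cV (level w a).
Proof.
move=> [_ _ wcv _ _] /andP[a0 a1].
have cvb b : convex_cV [set x | b <= w x].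
  move=> x y t /= bx b_y t01; have := wcv t y x t01.
  rewrite (_ : t *: y + (1 - t) *: x = x + t *: (y - x)).
    by apply: le_trans; rewrite le_min b_y.
  by rewrite scalerBl scale1r scalerBr addrCA.
rewrite /level; case: ifP => _; first exact: cvb.
(* At level 0 the set is the closure of a union of nested convex sets: two points of the union lie
   in a common one, that of the smaller threshold. *)
apply: convex_closure => x y t [b b01 bx] [c c01 cy] t01.
have [bc|cb] := leP b c.
  by exists b => //; apply: cvb => //; apply: le_trans cy.
by exists c => //; apply: cvb => //; apply: le_trans (ltW cb) bx.
Qed.

Lemma hausdorff_level w1 w2 a : 0 <= a <= 1 ->
  (hausdorff (level w1 a) (level w2 a) <= fuzzy_dist w1 w2)%E.
Proof. by move=> a01; apply: ereal_sup_ubound; exists a => //=; rewrite in_itv. Qed.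

Lemma level_fuzzy_zero a : 0 <= a <= 1 -> level (@fuzzy_zero R n) a = [set 0].
Proof.
move=> /andP[a0 a1].
have lev0 b : 0 < b -> b <= 1 -> [set x | b <= @fuzzy_zero R n x] = [set 0].
  move=> b0 b1; apply/seteqP; split=> x /=; rewrite /fuzzy_zero.
    by case: eqP => // _ /=; rewrite leNgt b0.
  by move->; rewrite eqxx.
rewrite /level; case: ifP => a_gt0; first exact: lev0.
rewrite (_ : \bigcup_(b in _) _ = [set 0]).
  by rewrite -(closure_id _).1//; apply: compact_closed;
    [exact: norm_hausdorff|exact: compact_set1].
apply/seteqP; split=> x.
  move=> [b /=]; rewrite in_itv /= => /andP[b0 b1] bx.
  by have : [set x | b <= @fuzzy_zero R n x] x by []; rewrite lev0.
by move->; exists 1; rewrite /= ?in_itv /= ?ltr01 ?lexx// /fuzzy_zero eqxx.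
Qed.

Lemma level_norm_le w a (p : R) x : 0 <= a <= 1 ->
  (fuzzy_norm w <= p%:E)%E -> level w a x -> enorm x <= p.
Proof.
move=> a01 wp ax; rewrite -lee_fin.
have := le_trans (hausdorff_level w (@fuzzy_zero R n) a01) wp.
rewrite level_fuzzy_zero// /hausdorff ge_max => /andP[H _].
apply: le_trans H; apply: ereal_sup_ubound; exists x => //.
by rewrite /edist_to image_set1 ereal_inf1 subr0.
Qed.

End levels.

Lemma Lfun_oo_bound (R : realType) (T : R) (p : R -> R) :
  p \_ `[0, T] \in Lfun (@lebesgue_measure R) +oo%E ->
  exists P : R, {ae @lebesgue_measure R, forall t, t \in `[0, T] -> p t <= P}.
Proof.
rewrite inE => /andP[_]; rewrite inE /= /finite_norm unlock /Lnorm.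
have -> : (0 < @lebesgue_measure R [set: R])%E.
  apply: (@lt_le_trans _ _ (@lebesgue_measure R `[0, 1]%classic)).
    by rewrite lebesgue_measure_itv /= lte_fin ltr01 sube0 lte_fin.
  by apply: le_measure; rewrite ?inE//; exact: measurable_itv.
move=> H; have [P HP] : exists P : R,
    (ess_sup (@lebesgue_measure R) (abse \o (EFin \o (p \_ `[0, T])%R)) <= P%:E)%E.
  case: ess_sup H => [r _|//|_]; first by exists r.
  by exists 0; rewrite leNye.
exists P; move/ess_supP: HP.
apply: (@filterS _ _ (ae_filter_ringOfSetsType (@lebesgue_measure R))) => t /=.
rewrite lee_fin => Ht tJ; apply: le_trans (ler_norm _) _; move: Ht.
by rewrite patchE mem_set.
Qed.

Section vi.
Variables (R : realType) (m : nat).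
Implicit Types (K : set 'cV[R]_m) (u v w : 'cV[R]_m).

Lemma convex_set_cV K : convex_set K -> convex_cV K.
Proof.
move=> Kcv u v t Ku Kv /andP[t0 t1].
have := Kcv v u (Itv01 t0 t1) (mem_set Kv) (mem_set Ku); rewrite inE.
rewrite [X in K X -> _](_ : _ = t *: v + (1 - t) *: u)//.
by rewrite scalerBl scale1r scalerBr addrCA.
Qed.

(** Minty's trick: test with u + (v - u) / (k + 1), divide by 1 / (k + 1), and use continuity of [S]
    as k tends to infinity. *)
Lemma minty K (S : 'cV[R]_m -> 'cV[R]_m) w u : convex_cV K -> continuous S ->
  K u -> (forall v, K v -> 0 <= dot (w + S v) (v - u)) ->
  SOL K (fun u => w + S u) u.
Proof.
move=> Kcv Sc Ku H; split=> // v Kv.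
have cu : (fun k : nat => u + k.+1%:R^-1 *: (v - u)) @ \oo --> u.
  rewrite -[X in _ --> X]addr0; apply: cvgD; first exact: cvg_cst.
  rewrite -[X in _ --> X](scale0r (v - u)); apply: cvgZl.
  exact: cvg_harmonic.
have cS := cvg_comp _ _ cu (Sc u).
have : (fun k : nat => dot (w + S (u + k.+1%:R^-1 *: (v - u))) (v - u)) @ \oo -->
    dot (w + S u) (v - u).
  by apply: cvg_dot; [apply: cvgD => //; exact: cvg_cst|exact: cvg_cst].
move=> /(ler_cvg_to (cvg_cst 0)); apply; apply: nearW => k.
have k0 : 0 < k.+1%:R^-1 :> R by rewrite invr_gt0.
have := H _ (Kcv u v k.+1%:R^-1 Ku Kv _).
rewrite [X in dot _ X]addrC addKr dotZr pmulr_rge0//; apply.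
by rewrite ltW// invf_le1// ler1n.
Qed.

Lemma monotone_minty K (S : 'cV[R]_m -> 'cV[R]_m) w u v : monotone_on K S ->
  SOL K (fun u => w + S u) u -> K v -> 0 <= dot (w + S v) (v - u).
Proof.
move=> Smon [Ku Hu] Kv; have := Hu v Kv; have := Smon v u Kv Ku.
by rewrite !dotE; lra.
Qed.

Definition truncation K (r : R) := K `&` [set u | enorm u <= r].

Lemma truncation_closed K r : closed K -> closed (truncation K r).
Proof.
move=> Kcl; apply: closedI => //.
rewrite (_ : mkset _ = (fun y => enorm (0 - y)) @^-1` [set s | s <= r]).
  apply: closed_comp; last exact: closed_le.
  by move=> y _; apply: continuous_enorm_dist.
by apply/seteqP; split=> y /=; rewrite sub0r enormN.
Qed.

Lemma truncation_convex K r : convex_cV K -> convex_cV (truncation K r).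
Proof.
move=> Kcv u v t [Ku ur] [Kv vr] t01; split; first exact: Kcv.
rewrite /= in ur vr *; case/andP: t01 => t0 t1.
have -> : u + t *: (v - u) = (1 - t) *: u + t *: v.
  by rewrite scalerBl scale1r scalerBr addrAC addrA.
apply: le_trans (enormD _ _) _; rewrite !enormZ !ger0_norm ?subr_ge0//.
by nra.
Qed.

(** As u is strictly inside the ball, a short piece of the segment from u to v stays in the
    truncation, and the inequality is homogeneous in v - u. [s] satisfies s |v - u| <= r - |u|, also
    when v = u. *)
Lemma truncated_SOL K (G : 'cV[R]_m -> 'cV[R]_m) u r : convex_cV K ->
  SOL (truncation K r) G u -> enorm u < r -> SOL K G u.
Proof.
move=> Kcv [[Ku ur] Hu] ur'; split=> // v Kv.
pose s := (r - enorm u) / (r - enorm u + enorm (v - u)).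
have d0 : 0 < r - enorm u by rewrite subr_gt0.
have e0 : 0 <= enorm (v - u) by apply: enorm_ge0.
have de0 : 0 < r - enorm u + enorm (v - u) by rewrite ltr_pwDl.
have s0 : 0 < s by rewrite divr_gt0.
have s1 : s <= 1 by rewrite ler_pdivrMr// mul1r lerDl.
have := Hu (u + s *: (v - u));
  rewrite [X in dot _ X]addrC addKr dotZr pmulr_rge0//; apply.
split; first by apply: Kcv => //; rewrite s1 ltW.
rewrite /=; apply: le_trans (enormD _ _) _; rewrite enormZ gtr0_norm//.
rewrite -lerBrDl /s mulrAC ler_pdivrMr// ler_wpM2l ?(ltW d0)//.
by rewrite lerDr ltW.
Qed.

(** Testing with [u0] gives c |u|^2 <= <S u, u - u0> <= <w, u0 - u> <= B (|u0| + |u|), at most B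
    (|u0| + 1) |u| once |u| > 1. [C] collects the threshold [M] of the growth condition, 1, |u0| (so
    that [u0] lies in every truncation of radius at least [C]) and the resulting bound; it depends
    neither on w nor on r. *)
Lemma coercive_bound K (S : 'cV[R]_m -> 'cV[R]_m) (eta : R) u0 : K u0 ->
  (0 < limf_einf (fun u => (dot (S u) (u - u0) / enorm u ^+ 2)%:E)
          (at_infty_in K))%E ->
  exists C : R, [/\ 0 <= C, enorm u0 <= C &
    forall w u (r : R), enorm w <= eta -> K u -> enorm u <= r -> C <= r ->
      (forall v, truncation K r v -> 0 <= dot (w + S u) (v - u)) -> enorm u <= C].
Proof.
move=> Ku0; rewrite limf_einfE => /ereal_sup_gt[_ [V FV <-]] Vpos.
have [c [c0 Hc]] : exists c : R, 0 < c /\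
    forall u, V u -> c <= dot (S u) (u - u0) / enorm u ^+ 2.
  have Hlb c : (c%:E <= ereal_inf [set (dot (S u) (u - u0) / enorm u ^+ 2)%:E
    | u in V])%E ->
      forall u, V u -> c <= dot (S u) (u - u0) / enorm u ^+ 2.
    move=> Hc u Vu; rewrite -lee_fin; apply: le_trans Hc _.
    by apply: ereal_inf_lbound; exists u.
  move: Vpos Hlb; case: ereal_inf => [r r0 Hlb|_ Hlb|//].
    by exists r; split; [rewrite -lte_fin|apply: Hlb].
  by exists 1; split => //; apply: Hlb; rewrite leey.
case: FV => M _ HM.
have HV u : K u -> M < enorm u -> V u by move=> Ku Mu; apply: HM.
pose B := Num.max eta 0.
pose C := Num.max (Num.max M 1) (Num.max (enorm u0) (B * (enorm u0 + 1) / c)).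
exists C; split.
- by rewrite /C !le_max ler01 orbT.
- by rewrite /C !le_max lexx !orbT.
move=> w u r wB Ku ur Cr Hu.
rewrite leNgt; apply/negP => Cu; move: (Cu).
rewrite /C !gt_max => /andP[/andP[Mu u1] /andP[u0u Bu]].
have Vu := HV u Ku Mu.
have un0 : 0 < enorm u by apply: lt_trans u1.
have := Hc u Vu; rewrite ler_pdivlMr ?exprn_gt0// => H1.
have Tu0 : truncation K r u0.
  by split=> //=; apply: le_trans Cr; rewrite /C !le_max lexx !orbT.
have := Hu u0 Tu0; rewrite dotDl => H2.
have H3 : dot w (u0 - u) <= B * (enorm u0 + enorm u).
  apply: le_trans (cauchy_schwarz _ _) _; apply: ler_pM; rewrite ?enorm_ge0//.
    by rewrite le_max wB.
  by rewrite -(enormN u); apply: enormD.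
have B0 : 0 <= B by rewrite le_max lexx orbT.
have H4 : c * enorm u ^+ 2 <= B * (enorm u0 + enorm u).
  by apply: le_trans H1 _; move: H2 H3; rewrite !dotE; lra.
move: Bu; rewrite ltr_pdivrMr// => Bu.
have H5 : B * (enorm u0 + enorm u) <= B * (enorm u0 + 1) * enorm u.
  rewrite -mulrA ler_wpM2l// mulrDl mul1r lerD2r.
  by rewrite ler_peMr ?enorm_ge0// ltW.
have := le_trans H4 H5; rewrite expr2 mulrA ler_pM2r//; lra.
Qed.

End vi.

(** * The integral operator *)

Section power_kernel.
Variables (R : realType) (T r : R).
Hypotheses (T0 : 0 < T) (r0 : 0 < r) (r1 : r <= 1).
Local Notation J := (`[0, T]%classic : set R).

Lemma powR_incr (a b : R) : 0 <= a -> a <= b -> a `^ r <= b `^ r.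
Proof.
move=> a0 ab; apply: (ge0_ler_powR (ltW r0)) => //; rewrite nnegrE//.
exact: le_trans ab.
Qed.

Lemma le_powR (x : R) : 0 <= x <= 1 -> x <= x `^ r.
Proof.
move=> /andP[x0 x1]; have [->|xn0] := eqVneq x 0; first exact: powR_ge0.
have xp : 0 < x by rewrite lt0r xn0.
have b1 : 0 < x `^ r <= 1.
  by have := powR_incr x0 x1; rewrite powR1 powR_gt0.
have := ge1r_powR b1 (_ : 1 <= r^-1); rewrite -powRrM divff ?gt_eqF// powRr1//.
by apply; rewrite invf_ge1.
Qed.

(** After division by a^r this is x <= x^r on [0, 1], applied to b / a and (a - b) / a, whose sum is
    1. *)
Lemma powR_sub (a b : R) : 0 <= b -> b <= a -> a `^ r - b `^ r <= (a - b) `^ r.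
Proof.
move=> b0 ba; have [a0|a0] := leP a 0.
  have -> : a = b by apply/eqP; rewrite eq_le ba (le_trans a0).
  by rewrite subrr powR_ge0.
have x01 x : 0 <= x -> x <= a -> 0 <= x / a <= 1.
  by move=> x0 xa; rewrite divr_ge0 ?(ltW a0)//= ler_pdivrMr// mul1r.
have := le_powR (x01 b b0 ba).
have := le_powR (x01 (a - b) _ _); rewrite subr_ge0 gerBl => /(_ ba b0).
have E x : 0 <= x -> x `^ r = (x / a) `^ r * a `^ r.
  by move=> x0; rewrite -powRM ?divr_ge0 ?(ltW a0)// divfK ?gt_eqF.
rewrite (E b)// (E (a - b)) ?subr_ge0// => H1 H2.
have ar : 0 <= a `^ r by apply: powR_ge0.
rewrite lerBlDr -mulrDl -[leLHS]mul1r ler_wpM2r//.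
apply: le_trans (lerD H1 H2); rewrite -mulrDl subrK divff ?gt_eqF//.
Qed.

(** The power kernel extended by 0 beyond s = t, so that integrals over [0, t] become integrals over
    the fixed interval [0, T]. *)
Definition kap (t s : R) := Num.max (t - s) 0 `^ r.

Lemma kap_out t s : t <= s -> kap t s = 0.
Proof. by move=> ts; rewrite /kap max_r ?subr_le0// powR0// gt_eqF. Qed.

Lemma kap_in t s : s <= t -> kap t s = (t - s) `^ r.
Proof. by move=> st; rewrite /kap max_l// subr_ge0. Qed.

Lemma kap_bound t s : J t -> J s -> `|kap t s| <= T `^ r.
Proof.
rewrite /= !in_itv /= => /andP[t0 tT] /andP[s0 sT].
rewrite ger0_norm ?powR_ge0// powR_incr// ?le_max ?lexx ?orbT// ge_max (ltW
  T0) andbT.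
lra.
Qed.

Lemma kap_mod t t' s : `|kap t s - kap t' s| <= `|t - t'| `^ r.
Proof.
wlog tt' : t t' / t' <= t => [H|].
  by have [/H//|/ltW/H] := leP t' t; rewrite distrC [X in _ <= X `^ _]distrC.
have mono : Num.max (t' - s) 0 <= Num.max (t - s) 0.
  by rewrite ge_max !le_max lexx orbT andbT lerD2r tt'.
have m0 : 0 <= Num.max (t' - s) 0 by rewrite le_max lexx orbT.
rewrite ger0_norm; last by rewrite subr_ge0 powR_incr.
apply: le_trans (powR_sub m0 mono) _.
rewrite (ger0_norm (x := t - t')) ?subr_ge0// powR_incr ?subr_ge0//.
have [h|h] := leP 0 (t' - s).
  have h' : 0 <= t - s by lra.
  by rewrite (max_l h'); lra.
rewrite subr0 ge_max; apply/andP; split; lra.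
Qed.

Lemma kap_measurable t : measurable_fun J (kap t).
Proof.
apply: (measurableT_comp (measurable_powR r)).
apply: measurable_maxr; last exact: measurable_cst.
by apply: measurable_funB; [exact: measurable_cst|exact: measurable_id].
Qed.

Lemma powR_modulus (A B : R) :
  (fun N : nat => A * (T / N.+1%:R) `^ r + B * (T / N.+1%:R)) @ \oo --> 0.
Proof.
have HT : (fun N : nat => T / N.+1%:R) @ \oo --> 0 by apply: cvg_invSn.
have Hr : (fun N : nat => (T / N.+1%:R) `^ r) @ \oo --> 0.
  apply/cvgrPdist_le => e e0.
  have d0 : 0 < e `^ r^-1 by apply: powR_gt0.
  move/cvgrPdist_le: HT => /(_ _ d0); apply: filterS => N.
  have h0 : 0 <= T / N.+1%:R by rewrite divr_ge0// ltW.
  rewrite !sub0r !normrN (ger0_norm h0) ger0_norm ?powR_ge0// => H.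
  have -> : e = (e `^ r^-1) `^ r.
    by rewrite -powRrM mulVf ?gt_eqF// powRr1// ltW.
  exact: powR_incr h0 H.
have HA : (fun N : nat => A * (T / N.+1%:R) `^ r) @ \oo --> A * 0.
  by apply: cvgM; first exact: cvg_cst.
have HB : (fun N : nat => B * (T / N.+1%:R)) @ \oo --> B * 0.
  by apply: cvgM; first exact: cvg_cst.
have := cvgD HA HB; rewrite !mulr0 addr0; exact.
Qed.

End power_kernel.

Section integral_operator.
Variables (R : realType) (n m : nat) (T r cG Bd : R).
Variables (f : R -> 'cV[R]_n -> 'cV[R]_n) (g : R -> 'cV[R]_n -> 'M[R]_(n, m)).
Variables (c1 c2 : R -> 'cV[R]_n -> 'cV[R]_n).
Hypotheses (T0 : 0 < T) (r0 : 0 < r) (r1 : r <= 1) (Bd0 : 0 <= Bd).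
Local Notation J := (`[0, T]%classic : set R).

Definition caratheodory (phi : R -> 'cV[R]_n -> R) :=
  [/\ forall z, measurable_fun J (fun t => phi t z),
      forall t z, J t -> `|phi t z| <= Bd &
      forall t (zs : nat -> 'cV[R]_n) z, J t -> zs @ \oo --> z ->
        (fun k => phi t (zs k)) @ \oo --> phi t z].

Hypotheses (fC : forall i, caratheodory (fun t z => f t z i 0))
  (gC : forall i j, caratheodory (fun t z => g t z i j))
  (c1C : forall i, caratheodory (fun t z => c1 t z i 0))
  (c2C : forall i, caratheodory (fun t z => c2 t z i 0)).

(* Composition with z preserves measurability; it holds for step functions and is
   stable under pointwise limits, which covers all the states needed. *)
Definition superposable (z : R -> 'cV[R]_n) :=
  forall phi, caratheodory phi -> measurable_fun J (fun s => phi s (z s)).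

Lemma superposable_cvg (zs : nat -> R -> 'cV[R]_n) z :
  (forall k, superposable (zs k)) ->
  (forall s, J s -> (fun k => zs k s) @ \oo --> z s) -> superposable z.
Proof.
move=> zsS zsz phi phiC; have [_ _ phic] := phiC.
apply: (@measurable_fun_cvg _ _ _ J (fun k s => phi s (zs k s))).
  by move=> k; apply: zsS.
by move=> s Js; apply: phic => //; apply: zsz.
Qed.

Lemma superposable_bmeas z phi : superposable z -> caratheodory phi ->
  bmeas T (fun s => phi s (z s)).
Proof.
move=> zS phiC; split; first exact: zS.
by exists Bd => s Js; have [_ + _] := phiC; apply.
Qed.

Lemma superposable_step (I : finType) (idx : R -> I) (a : I -> 'cV[R]_n) :
  (forall j, measurable_fun J (fun s => (idx s == j)%:R : R)) ->
  superposable (fun s => a (idx s)).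
Proof.
move=> midx phi [mphi phiB _].
have [] := @bmeas_step _ T _ idx (fun j s => phi s (a j)) midx => // j.
by split; [exact: mphi|exists Bd => s Js; apply: phiB].
Qed.

(** With [cG] = 1 / Gamma(q) this is the Green kernel of the boundary value problem; on [0, T] it
    vanishes at t = 0 and t = T. *)
Definition kk t s := cG * (kap r t s - t / T * kap r T s).

Definition kkmax := `|cG| * (2 * T `^ r).

Lemma kk_bmeas t : J t -> bmeas T (kk t).
Proof.
have bk t' : J t' -> bmeas T (kap r t').
  move=> Jt; split; first exact: kap_measurable.
  by exists (T `^ r) => s Js; apply: kap_bound.
move=> Jt; apply: bmeasZ; apply: bmeasB; first exact: bk.
by apply/bmeasZ/bk; rewrite /= in_itv /= lexx (ltW T0).
Qed.

Lemma J_ratio t : J t -> 0 <= t / T <= 1.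
Proof.
rewrite /= in_itv /= => /andP[t0 t1].
by rewrite divr_ge0 ?(ltW T0)//= ler_pdivrMr// mul1r.
Qed.

Lemma JT : J T.
Proof. by rewrite /= in_itv /= lexx (ltW T0). Qed.

Lemma kk_bound t s : J t -> J s -> `|kk t s| <= kkmax.
Proof.
move=> Jt Js; rewrite normrM ler_wpM2l// mulr_natl mulr2n.
apply: le_trans (ler_normB _ _) _; rewrite lerD//; first exact: kap_bound.
have /andP[a0 a1] := J_ratio Jt.
rewrite normrM ger0_norm// -[leRHS]mul1r ler_pM//.
by apply: kap_bound => //; apply: JT.
Qed.

Lemma kk_mod t t' s : J s ->
  `|kk t s - kk t' s| <= `|cG| * (`|t - t'| `^ r + `|t - t'| / T * T `^ r).
Proof.
move=> Js; rewrite -mulrBr normrM ler_wpM2l//.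
rewrite (_ : _ - _ = kap r t s - kap r t' s - (t - t') / T * kap r T s);
  last by ring.
apply: le_trans (ler_normB _ _) _; rewrite lerD//; first exact: kap_mod.
rewrite !normrM normfV (gtr0_norm T0) ler_wpM2l ?divr_ge0 ?(ltW T0)//.
by apply: kap_bound => //; apply: JT.
Qed.

(* The right-hand side of the mild formulation, as the integral of a single
   function over [0, T]. *)
Definition integrand t i s (z : 'cV[R]_n) (u : 'cV[R]_m) : R :=
  kk t s * (f s z i 0 + (g s z *m u) i 0) + t / T * c2 s z i 0
  + (1 - t / T) * c1 s z i 0.

Lemma integrand_cvg t i s (zs : nat -> 'cV[R]_n) (us : nat -> 'cV[R]_m) z u :
  J s -> zs @ \oo --> z -> us @ \oo --> u ->
  (fun k => integrand t i s (zs k) (us k)) @ \oo --> integrand t i s z u.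
Proof.
move=> Js zsz /cvg_colP usu.
have lim phi (H : caratheodory phi) : (fun k => phi s (zs k)) @ \oo --> phi s z.
  by have [_ _ +] := H; apply.
have lg : (fun k => (g s (zs k) *m us k) i 0) @ \oo --> (g s z *m u) i 0.
  rewrite mxE (_ : (fun k => _) = fun k => \sum_j g s (zs k) i j * us k j 0).
    apply: cvg_big => [|j _]; first exact: add_continuous.
    by apply: cvgM; [exact: (lim _ (gC i j))|exact: usu].
  by apply/funext => k; rewrite mxE.
apply: cvgD; first apply: cvgD.
- apply: cvgM; first exact: cvg_cst.
  by apply: cvgD => //; exact: (lim _ (fC i)).
- by apply: cvgM; [exact: cvg_cst|exact: (lim _ (c2C i))].
- by apply: cvgM; [exact: cvg_cst|exact: (lim _ (c1C i))].
Qed.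

Lemma integrand_bmeas t i z u : J t -> superposable z -> vbmeas T u ->
  bmeas T (fun s => integrand t i s (z s) (u s)).
Proof.
move=> Jt zS bu; have sb phi := @superposable_bmeas z phi zS.
apply: bmeasD; first apply: bmeasD.
- apply: bmeasM; first exact: kk_bmeas.
  apply: bmeasD; first exact: (sb _ (fC i)).
  apply: (@bmeas_eq _ _ (fun s => \sum_j g s (z s) i j * u s j 0)).
    by move=> s _; rewrite mxE.
  by apply: bmeas_sum => j; apply: bmeasM; [exact: (sb _ (gC i j))|exact: bu].
- by apply: bmeasZ; exact: (sb _ (c2C i)).
- by apply: bmeasZ; exact: (sb _ (c1C i)).
Qed.

Definition hmax (C : R) := Bd + m%:R * (Bd * C).

Lemma hmax_ge0 C : 0 <= C -> 0 <= hmax C.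
Proof. by move=> C0; rewrite addr_ge0// mulr_ge0// mulr_ge0. Qed.

Lemma h_bound C i s z (u : 'cV[R]_m) : J s -> (forall j, `|u j 0| <= C) ->
  `|f s z i 0 + (g s z *m u) i 0| <= hmax C.
Proof.
move=> Js uC; apply: le_trans (ler_normD _ _) _; rewrite lerD//.
  by have [_ + _] := fC i; apply.
rewrite mxE; apply: le_trans (ler_norm_sum _ _ _) _.
rewrite mulr_natl -[X in _ *+ X]card_ord -sumr_const; apply: ler_sum => j _.
by rewrite normrM ler_pM//; have [_ + _] := gC i j; apply.
Qed.

Definition Wmax (C : R) := kkmax * hmax C + 2 * Bd.

Lemma integrand_bound C t i s z (u : 'cV[R]_m) : J t -> J s ->
  (forall j, `|u j 0| <= C) ->
  `|integrand t i s z u| <= Wmax C.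
Proof.
move=> Jt Js uC; rewrite /integrand /Wmax -addrA.
apply: le_trans (ler_normD _ _) _; rewrite lerD//.
  by rewrite normrM ler_pM// ?kk_bound// h_bound.
have /andP[a0 a1] := J_ratio Jt.
have H1 : `|c1 s z i 0| <= Bd by have [_ + _] := c1C i; apply.
have H2 : `|c2 s z i 0| <= Bd by have [_ + _] := c2C i; apply.
apply: le_trans (ler_normD _ _) _.
rewrite (normrM (t / T)) (normrM (1 - t / T)) (ger0_norm a0) (ger0_norm (x :=
  1 - _)) ?subr_ge0//.
have b0 : 0 <= 1 - t / T by rewrite subr_ge0.
have b1 : 1 - t / T <= 1 by rewrite gerBl.
have := ler_pM a0 (normr_ge0 _) a1 H2; have := ler_pM b0 (normr_ge0 _) b1 H1.
lra.
Qed.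

(** [modA] is the Hoelder constant in t, coming from [kap]; [modB] is the Lipschitz constant, coming
    from the terms in t / T. *)
Definition modA (C : R) := `|cG| * hmax C.
Definition modB (C : R) := `|cG| * T `^ r * hmax C / T + 2 * Bd / T.

Lemma integrand_mod C t t' i s z (u : 'cV[R]_m) : J s -> 0 <= C ->
  (forall j, `|u j 0| <= C) ->
  `|integrand t i s z u - integrand t' i s z u| <=
  modA C * `|t - t'| `^ r + modB C * `|t - t'|.
Proof.
move=> Js C0 uC.
have H1 : `|c1 s z i 0| <= Bd by have [_ + _] := c1C i; apply.
have H2 : `|c2 s z i 0| <= Bd by have [_ + _] := c2C i; apply.
have Hh := h_bound i z Js uC.
have Hk := kk_mod t t' Js.
rewrite /integrand; move: (f s z i 0 + _) Hh (c1 s z i 0) (c2 s z i 0) H1 H2.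
move=> h Hh d1 d2 H1 H2.
have -> : kk t s * h + t / T * d2 + (1 - t / T) * d1 -
    (kk t' s * h + t' / T * d2 + (1 - t' / T) * d1) =
    (kk t s - kk t' s) * h + (t - t') / T * (d2 - d1).
  by field; rewrite gt_eqF.
apply: le_trans (ler_normD _ _) _.
rewrite !normrM normfV (gtr0_norm T0).
have h0 := hmax_ge0 C0.
have d12 : `|d2 - d1| <= 2 * Bd.
  by apply: le_trans (ler_normB _ _) _; rewrite mulr_natl mulr2n lerD.
have p1 := ler_pM (normr_ge0 _) (normr_ge0 _) Hk Hh.
have dT0 : 0 <= `|t - t'| / T by rewrite divr_ge0// ltW.
have p2 := ler_wpM2l dT0 d12.
apply: le_trans (lerD p1 p2) _.
by rewrite le_eqVlt; apply/orP; left; apply/eqP; rewrite /modA /modB; field;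
  rewrite gt_eqF.
Qed.


Definition node N (j : nat) : R := T * j%:R / N.+1%:R.

Lemma node_J N (j : 'I_N.+1) : J (node N j).
Proof.
rewrite /= in_itv /= /node divr_ge0 ?mulr_ge0 ?(ltW T0)//=.
by rewrite ler_pdivrMr ?ltr0n// ler_pM2l// ler_nat ltnW.
Qed.

Lemma grid N : exists idx : R -> 'I_N.+1,
  (forall j, measurable_fun J (fun s => (idx s == j)%:R : R)) /\
  forall s, J s -> `|s - node N (idx s)| <= T / N.+1%:R.
Proof.
have N0 : 0 < N.+1%:R :> R by rewrite ltr0n.
pose x s : R := s * N.+1%:R / T.
(* The minimum puts the right endpoint s = T into the last cell. *)
pose idx s : 'I_N.+1 := inord (minn N (Num.truncn (x s))).
have idxE s : idx s = minn N (Num.truncn (x s)) :> nat.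
  by rewrite inordK// ltnS geq_minl.
have x0 s : J s -> 0 <= x s.
  by rewrite /= in_itv /= => /andP[s0 _]; rewrite divr_ge0 ?mulr_ge0 ?(ltW T0).
have le_idx s j : J s -> (j <= N)%N -> (j <= idx s)%N = (node N j <= s).
  move=> Js jN; rewrite idxE leq_min jN truncn_ge_nat ?x0//.
  by rewrite /x /node ler_pdivlMr// ler_pdivrMr// mulrC.
have mind (a : R) : measurable_fun J (fun s => (a <= s)%R%:R : R).
  rewrite (_ : (fun s => _) = \1_(`[a, +oo[%classic)).
    by apply: measurable_indic; exact: measurable_itv.
  by apply/funext => s; rewrite indicE mem_setE in_itv /= andbT.
exists idx; split=> [j|s Js].
  have [jN|Nj] := ltnP j N; last first.
    apply: eq_measurable_fun (mind (node N j)) => s /set_mem Js.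
    have jN : (j <= N)%N by rewrite -ltnS.
    rewrite -le_idx// -val_eqE /= eq_sym eqn_leq; congr (_%:R).
    by rewrite [X in _ && X](_ : _ = true) ?andbT// (leq_trans _ Nj)// -ltnS.
  apply: (@eq_measurable_fun _ _ _ _ _
      (fun s => (node N j <= s)%R%:R - (node N j.+1 <= s)%R%:R : R)); last first.
    by apply: measurable_funB; apply: mind.
  move=> s /set_mem Js; rewrite -!le_idx ?(ltnW jN)// -val_eqE /=.
  by case: ltngtP => _; rewrite ?subrr ?subr0.
have NN := idxE s; have Tr := truncn_itv (x0 s Js).
have xN : x s <= N.+1%:R.
  move: Js; rewrite /= in_itv /= => /andP[_ sT].
  by rewrite /x ler_pdivrMr// mulrC ler_pM2l.
have /andP[h1 h2] : (idx s)%:R <= x s <= (idx s).+1%:R.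
  rewrite NN; case/andP: Tr => t1 t2; have [h|h] := leqP N (Num.truncn (x s)).
    by rewrite xN andbT (le_trans _ t1)// ler_nat.
  by rewrite t1 ltW.
have TN : 0 < T / N.+1%:R by rewrite divr_gt0.
have -> : s - node N (idx s) = T / N.+1%:R * (x s - (idx s)%:R).
  by rewrite /x /node; field; rewrite !gt_eqF.
rewrite normrM (gtr0_norm TN).
rewrite ler_piMr ?(ltW TN)// ger0_norm ?subr_ge0// lerBlDr.
by rewrite -natr1 addrC in h2.
Qed.

Variables (Q : R -> 'cV[R]_n -> 'cV[R]_m) (S : 'cV[R]_m -> 'cV[R]_m).
Variables (KR : set 'cV[R]_m) (rad : R).
Hypotheses (KR0 : KR !=set0) (KRcl : closed KR) (KRcv : convex_cV KR).
Hypothesis KRrad : forall u, KR u -> enorm u <= rad.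
Hypothesis Sc : continuous S.
Hypothesis Qc : forall t (zs : nat -> 'cV[R]_n) z, J t -> zs @ \oo --> z ->
  (fun k => Q t (zs k)) @ \oo --> Q t z.

Let KRcoord u j : KR u -> `|u j 0| <= rad.
Proof. by move=> Ku; apply: le_trans (coord_le_enorm _ _) (KRrad Ku). Qed.

Let rad0 : 0 <= rad.
Proof. by have [u Ku] := KR0; apply: le_trans (enorm_ge0 u) (KRrad Ku). Qed.

(* The unknowns are the values of the state and of the control on the cells of
   the grid; the variational inequality u in SOL is the fixed-point equation
   u = eproj (u - (Q + S u)). *)
Lemma galerkin N (idx : R -> 'I_N.+1) :
  (forall j, measurable_fun J (fun s => (idx s == j)%:R : R)) ->
  exists (a : 'I_N.+1 -> 'cV[R]_n) (U : 'I_N.+1 -> 'cV[R]_m),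
    [/\ forall j, KR (U j),
        forall (j : 'I_N.+1) v, KR v ->
          0 <= dot (Q (node N j) (a j) + S (U j)) (v - U j) &
        forall (j : 'I_N.+1) i, a j i 0 =
          intJ T (fun s => integrand (node N j) i s (a (idx s)) (U (idx s)))].
Proof.
move=> midx.
pose I := ('I_N.+1 * ('I_n + 'I_m))%type.
pose A (x : I -> R) j : 'cV[R]_n := \col_i x (j, inl i).
(* Projecting the control unknowns makes every x admissible and keeps [Fn] bounded; at a fixed point
   they already lie in [KR], so the projection disappears ([VE]). *)
pose V (x : I -> R) j : 'cV[R]_m := eproj KR (\col_i x (j, inr i)).
have VK x j : KR (V x j) by apply: eproj_in.
pose Fn (x : I -> R) (p : I) : R := match p with
  | (j, inl i) => intJ T (fun s =>
    integrand (node N j) i s (A x (idx s)) (V x (idx s)))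
  | (j, inr i) => eproj KR (V x j - (Q (node N j) (A x j) + S (V x j))) i 0
  end.
have integrand_ok x (j : 'I_N.+1) i :
    bmeas T (fun s => integrand (node N j) i s (A x (idx s)) (V x (idx s))) /\
    bounded_by T (fun s => integrand (node N j) i s (A x (idx s)) (V x (idx
      s))) (Wmax rad).
  split.
    apply: integrand_bmeas; first exact: node_J.
      exact: superposable_step.
    move=> l; apply: (@bmeas_step _ _ _ idx (fun p _ => V x p l 0)) => // p.
    exact: bmeas_cst.
  move=> s Js; apply: integrand_bound => //; first exact: node_J.
  by move=> l; apply: KRcoord.
have kk0 : 0 <= kkmax.
  by apply: mulr_ge0 => //; apply: mulr_ge0 => //; apply: powR_ge0.
have Wmax0 : 0 <= Wmax rad.
  by apply: addr_ge0; apply: mulr_ge0 => //; apply: hmax_ge0.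
pose B := Wmax rad * T + rad + 1.
have B0 : 0 < B by rewrite ltr_wpDl// addr_ge0 ?mulr_ge0// ltW.
have [||x [xB xfix]] := @brouwer R I B Fn B0.
- move=> x _ [j [i|i]] /=.
    have [bI BI] := integrand_ok x j i; apply: le_trans (intJ_bound T0 bI BI) _.
    by rewrite /B -addrA lerDl addr_ge0.
  apply: le_trans (KRcoord i (eproj_in KR0 KRcl KRcv _)) _.
  by rewrite /B addrAC lerDr addr_ge0// mulr_ge0// ltW.
- move=> u l _ ul.
  have Aul j : (fun k => A (u k) j) @ \oo --> A l j.
    by apply/cvg_colP => i; rewrite mxE; under eq_cvg do rewrite mxE; apply: ul.
  have Vul j : (fun k => V (u k) j) @ \oo --> V l j.
    apply: eproj_cvg => //.
    by apply/cvg_colP => i; rewrite mxE; under eq_cvg do rewrite mxE; apply: ul.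
  move=> [j [i|i]] /=.
    have [bl _] := integrand_ok l j i.
    apply: (@intJ_cvg _ _ T0 _ _ (Wmax rad)) => //.
    + by move=> k; have [] := integrand_ok (u k) j i.
    + by move=> k; have [] := integrand_ok (u k) j i.
    + by apply: aeW => s Js; apply: integrand_cvg.
  have : (fun k => eproj KR (V (u k) j - (Q (node N j) (A (u k) j) + S (V (u
    k) j))))
      @ \oo --> eproj KR (V l j - (Q (node N j) (A l j) + S (V l j))).
    apply: eproj_cvg => //; apply: cvgB; first exact: Vul.
    apply: cvgD; first by apply: Qc; [exact: node_J|exact: Aul].
    exact: (cvg_comp _ _ (Vul j) (@Sc (V l j))).
  by move=> /cvg_colP; apply.
have UE j : \col_i x (j, inr i) = eproj KR (V x j - (Q (node N j) (A x j) + S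
  (V x j))).
  by apply/colP => i; rewrite mxE -(xfix (j, inr i)).
have VE j : V x j = \col_i x (j, inr i).
  by rewrite /V eproj_fix// UE; apply: eproj_in.
exists (A x), (V x); split => //.
- move=> j v Kv; have := eproj_dot KR0 KRcl KRcv
    (V x j - (Q (node N j) (A x j) + S (V x j))) Kv.
  by rewrite -UE -VE addrC addKr dotNl oppr_le0.
- by move=> j i; rewrite mxE -(xfix (j, inl i)).
Qed.

End integral_operator.

(** * Passage to the limit *)

(** [y] is the limit along an ultrafilter at each time separately, and it inherits the modulus [om].
    Closeness at the finitely many nodes of one grid and the moduli of [y] and of [ys], each at most
    a third of 1 / (m + 1), give uniform closeness. *)
Lemma ascoli_subseq (R : realType) (n : nat) (T : R) (ys : nat -> R -> 'cV[R]_n)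
    (B : R) (om : nat -> R) : 0 < T ->
  (forall k t i, `[0, T]%classic t -> `|ys k t i 0| <= B) ->
  om @ \oo --> 0 ->
  (forall k N t t' i, `[0, T]%classic t -> `[0, T]%classic t' ->
     `|t - t'| <= T / N.+1%:R -> `|ys k t i 0 - ys k t' i 0| <= om N) ->
  exists (kappa : nat -> nat) (y : R -> 'cV[R]_n), (forall m, (m <= kappa m)%N) /\
    forall m t i, `[0, T]%classic t ->
      `|y t i 0 - ys (kappa m) t i 0| <= m.+1%:R^-1.
Proof.
move=> T0 yB om0 ymod; have [U [UU Um]] := free_ultrafilter.
have /choice[l Hl] : forall p : R * 'I_n, exists l : R, `[0, T]%classic p.1 ->
    (fun k => ys k p.1 p.2 0) @ U --> l.
  move=> [t i]; have [Jt|Jt] := pselect (`[0, T]%classic t); last by exists 0.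
  by have [l Hl] := cvg_ultra UU (fun k => yB k t i Jt); exists l.
pose y t : 'cV[R]_n := \col_i l (t, i).
have ylim t i : `[0, T]%classic t -> (fun k => ys k t i 0) @ U --> y t i 0.
  by move=> Jt; rewrite mxE; apply: (Hl (t, i)).
have ymod' N t t' i : `[0, T]%classic t -> `[0, T]%classic t' ->
    `|t - t'| <= T / N.+1%:R -> `|y t i 0 - y t' i 0| <= om N.
  move=> Jt Jt' tt'.
  apply/ler_addgt0Pr => e e0.
  have e2 : 0 < e / 2 by rewrite divr_gt0.
  have [k [H1 H2]] : exists k, `|y t i 0 - ys k t i 0| <= e / 2 /\
      `|y t' i 0 - ys k t' i 0| <= e / 2.
    apply: (@filter_ex _ U); apply: filterI.
      by move/cvgrPdist_le: (ylim t i Jt) => /(_ _ e2).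
    by move/cvgrPdist_le: (ylim t' i Jt') => /(_ _ e2).
  move: H1 H2 (ymod k N t t' i Jt Jt' tt'); rewrite !ler_norml.
  move=> /andP[a1 a2] /andP[b1 b2] /andP[d1 d2]; apply/andP; split; lra.
have H m : exists k, (m <= k)%N /\
    forall t i, `[0, T]%classic t -> `|y t i 0 - ys k t i 0| <= m.+1%:R^-1.
  pose e : R := m.+1%:R^-1 / 3.
  have e0 : 0 < e by rewrite divr_gt0// invr_gt0.
  have [N HN] : exists N, `|om N| <= e.
    move/cvgrPdist_le: om0 => /(_ e e0) [N _ HN]; exists N.
    by have := HN N (leqnn N); rewrite /= sub0r normrN.
  have [k [mk Hk]] : exists k, (m <= k)%N /\ forall p : 'I_N.+1 * 'I_n,
      `|y (node T N p.1) p.2 0 - ys k (node T N p.1) p.2 0| <= e.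
    apply: (@filter_ex _ U); apply: filterI; first exact: Um.
    apply: filter_forall => p.
    by have /cvgrPdist_le/(_ e e0) := ylim _ p.2 (node_J T0 p.1).
  exists k; split=> // t i Jt.
  have [idx [_ near_node]] := grid T0 N.
  have Jn := node_J T0 (idx t).
  have h1 := ymod' N t _ i Jt Jn (near_node t Jt).
  have h2 := ymod k N t _ i Jt Jn (near_node t Jt).
  have h3 := Hk (idx t, i); rewrite /= in h3.
  have h4 : om N <= e by apply: le_trans (ler_norm _) HN.
  have e3 : m.+1%:R^-1 = 3 * e by rewrite /e; field.
  rewrite e3; move: h1 h2 h3; rewrite !ler_norml.
  move=> /andP[a1 a2] /andP[b1 b2] /andP[d1 d2]; apply/andP; split; lra.
have [kappa Hk] := choice H.
by exists kappa, y; split=> [m|m t i Jt]; have [mk] := Hk m; last apply.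
Qed.

Section existence.
Variables (R : realType) (n m : nat) (T r cG Bd eta : R).
Variables (f : R -> 'cV[R]_n -> 'cV[R]_n) (g : R -> 'cV[R]_n -> 'M[R]_(n, m)).
Variables (c1 c2 : R -> 'cV[R]_n -> 'cV[R]_n) (Q : R -> 'cV[R]_n -> 'cV[R]_m).
Variables (S : 'cV[R]_m -> 'cV[R]_m) (K : set 'cV[R]_m) (u0 : 'cV[R]_m).
Local Notation mu := (@lebesgue_measure R).
Local Notation J := (`[0, T]%classic : set R).
Hypotheses (T0 : 0 < T) (r0 : 0 < r) (r1 : r <= 1) (Bd0 : 0 <= Bd).
Hypotheses (fC : forall i, caratheodory T Bd (fun t z => f t z i 0))
  (gC : forall i j, caratheodory T Bd (fun t z => g t z i j))
  (c1C : forall i, caratheodory T Bd (fun t z => c1 t z i 0))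
  (c2C : forall i, caratheodory T Bd (fun t z => c2 t z i 0)).
Hypotheses (Kcl : closed K) (Kcv : convex_cV K) (Ku0 : K u0).
Hypotheses (Sc : continuous S) (Smon : monotone_on K S).
Hypothesis Scoer :
  (0 < limf_einf (fun u => (dot (S u) (u - u0) / enorm u ^+ 2)%:E)
         (at_infty_in K))%E.
(** Continuity is joint in t and z because the discrete inequalities evaluate [Q] at grid nodes
    rather than at the current time. *)
Hypothesis Qc : forall (ts : nat -> R) t (zs : nat -> 'cV[R]_n) z,
  (forall k, J (ts k)) -> J t -> ts @ \oo --> t -> zs @ \oo --> z ->
  (fun k => Q (ts k) (zs k)) @ \oo --> Q t z.
Hypothesis Qeta : forall t z, J t -> enorm (Q t z) <= eta.

Local Notation W := (integrand T r cG f g c1 c2).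

Lemma approximate_solutions : exists C : R, [/\ 0 <= C, enorm u0 <= C &
  forall N, exists (idx : R -> 'I_N.+1) (a : 'I_N.+1 -> 'cV[R]_n)
      (U : 'I_N.+1 -> 'cV[R]_m),
    [/\ forall j, measurable_fun J (fun s => (idx s == j)%:R : R),
        forall s, J s -> `|s - node T N (idx s)| <= T / N.+1%:R,
        forall j : 'I_N.+1, SOL K (fun u => Q (node T N j) (a j) + S u) (U j),
        forall j, enorm (U j) <= C &
        forall (j : 'I_N.+1) i, a j i 0 =
          intJ T (fun s => W (node T N j) i s (a (idx s)) (U (idx s)))]].
Proof.
have [C [C0 u0C HC]] := coercive_bound eta Ku0 Scoer.
exists C; split=> // N.
have [idx [midx near_node]] := grid T0 N.
(* One more than the a priori bound, so that solutions lie strictly inside the ball, as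
   [truncated_SOL] requires. *)
pose rad := C + 1.
have KR0 : truncation K rad !=set0.
  by exists u0; split=> //; rewrite /= /rad; apply: le_trans u0C _; rewrite lerDl.
have Qc' t (zs : nat -> 'cV[R]_n) z : J t -> zs @ \oo --> z ->
    (fun k => Q t (zs k)) @ \oo --> Q t z.
  by move=> Jt zsz; apply: (@Qc (fun=> t)) => //; apply: cvg_cst.
have [a [U [UK UVI aE]]] := @galerkin R n m T r cG Bd f g c1 c2 T0 r0 Bd0
  fC gC c1C c2C Q S (truncation K rad) rad KR0 (@truncation_closed R m K rad Kcl)
  (@truncation_convex R m K rad Kcv) (fun u H => H.2) Sc Qc' N idx midx.
have UC j : enorm (U j) <= C.
  have [KU Ur] := UK j.
  apply: (HC (Q (node T N j) (a j)) (U j) rad) => //.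
  - by apply: Qeta; apply: node_J.
  - by rewrite lerDl.
  - by move=> v Kv; apply: UVI.
exists idx, a, U; split => // j.
apply: (@truncated_SOL _ _ K (fun u => Q (node T N j) (a j) + S u) (U j) rad) => //.
  by split; [exact: UK|exact: UVI].
by apply: le_lt_trans (UC j) _; rewrite ltrDl.
Qed.

Let W_bmeas t i z (u : R -> 'cV[R]_m) : J t -> superposable T Bd z -> vbmeas T u ->
  bmeas T (fun s => W t i s (z s) (u s)).
Proof. exact: (integrand_bmeas cG T0 r0 fC gC c1C c2C). Qed.

Let W_bound C t i s z (u : 'cV[R]_m) : J t -> J s -> (forall j, `|u j 0| <= C) ->
  `|W t i s z u| <= Wmax m T r cG Bd C.
Proof. exact: (integrand_bound cG T0 r0 fC gC c1C c2C). Qed.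

Let W_mod C t t' i s z (u : 'cV[R]_m) : J s -> 0 <= C ->
  (forall j, `|u j 0| <= C) ->
  `|W t i s z u - W t' i s z u| <=
  modA m cG Bd C * `|t - t'| `^ r + modB m T r cG Bd C * `|t - t'|.
Proof. exact: (integrand_mod cG T0 r0 r1 Bd0 fC gC c1C c2C). Qed.

Let W_cvg t i s (zs : nat -> 'cV[R]_n) (us : nat -> 'cV[R]_m) z u :
  J s -> zs @ \oo --> z -> us @ \oo --> u ->
  (fun k => W t i s (zs k) (us k)) @ \oo --> W t i s z u.
Proof. exact: (integrand_cvg fC gC c1C c2C). Qed.

(* The values u(s) on the exceptional null set are set to u0, since u must be
   K-valued everywhere. *)
Lemma limit_solution : exists (y : R -> 'cV[R]_n) (u : R -> 'cV[R]_m) (C : R),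
  [/\ forall s, J s -> K (u s), vbmeas T u /\ forall s j, J s -> `|u s j 0| <= C,
      superposable T Bd y,
      {ae mu, forall s, J s -> SOL K (fun w => Q s (y s) + S w) (u s)} &
      forall t i, J t -> y t i 0 = intJ T (fun s => W t i s (y s) (u s))].
Proof.
have [C [C0 u0C HC]] := approximate_solutions.
pose Approx N (p : (R -> 'cV[R]_n) * (R -> 'cV[R]_m) * (R -> R)) :=
  let: (z, ub, nd) := p in
  [/\ superposable T Bd z, vbmeas T ub,
      forall s, J s -> J (nd s) /\ `|s - nd s| <= T / N.+1%:R,
      forall s, SOL K (fun u => Q (nd s) (z s) + S u) (ub s) /\ enorm (ub s) <= C &
      forall s i, z s i 0 = intJ T (fun s' => W (nd s) i s' (z s') (ub s'))].
have /choice[app Happ] : forall N, exists p, Approx N p.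
  move=> N; have [idx [a [U [midx near_node USOL UC aE]]]] := HC N.
  exists (fun s => a (idx s), fun s => U (idx s), fun s => node T N (idx s)).
  split => //.
  - exact: superposable_step.
  - move=> l; apply: (@bmeas_step _ _ _ idx (fun p _ => U p l 0)) => // p.
    exact: bmeas_cst.
  - by move=> s Js; split; [exact: node_J|exact: near_node].
pose zz N := (app N).1.1; pose uu N := (app N).1.2; pose nn N := (app N).2.
have {}Happ N : Approx N (zz N, uu N, nn N).
  by have := Happ N; rewrite /zz /uu /nn; case: (app N) => -[].
have uuC N s j : `|uu N s j 0| <= C.
  have [_ _ _ H _] := Happ N; have [_ H'] := H s.
  exact: le_trans (coord_le_enorm _ _) H'.
have Wok t i N : J t -> bmeas T (fun s => W t i s (zz N s) (uu N s)).
  by move=> Jt; have [zS bu _ _ _] := Happ N; apply: W_bmeas.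
(* The integral formula evaluated at every time: the step function [zz N] samples [ys N] at the
   nodes, and it is [ys N] that is equicontinuous. *)
pose ys N t : 'cV[R]_n := \col_i intJ T (fun s => W t i s (zz N s) (uu N s)).
pose WM := Wmax m T r cG Bd C.
pose mA := modA m cG Bd C; pose mB := modB m T r cG Bd C.
have hm0 : 0 <= hmax m Bd C by apply: hmax_ge0.
have mA0 : 0 <= mA by apply: mulr_ge0.
have mB0 : 0 <= mB.
  apply: addr_ge0; apply: divr_ge0; rewrite ?(ltW T0)//; last exact: mulr_ge0.
  by apply: mulr_ge0 => //; apply: mulr_ge0 => //; apply: powR_ge0.
pose om N := T * (mA * (T / N.+1%:R) `^ r + mB * (T / N.+1%:R)).
have om0 : om @ \oo --> 0.
  rewrite -[X in _ --> X](mulr0 T); apply: cvgM; first exact: cvg_cst.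
  exact: powR_modulus.
have ysmod k N t t' i : J t -> J t' -> `|t - t'| <= T / N.+1%:R ->
    `|ys k t i 0 - ys k t' i 0| <= om N.
  move=> Jt Jt' tt'; rewrite !mxE -intJB; try exact: Wok; last by [].
  rewrite /om mulrC; apply: intJ_bound => //.
    by apply: bmeasB; apply: Wok.
  move=> s Js; apply: (@le_trans _ _ (mA * `|t - t'| `^ r + mB * `|t - t'|)).
    by apply: W_mod => // j; apply: uuC.
  by rewrite lerD// ler_wpM2l// powR_incr.
have ysB k t i : J t -> `|ys k t i 0| <= WM * T.
  move=> Jt; rewrite mxE; apply: intJ_bound => //; first exact: Wok.
  by move=> s Js; apply: W_bound => // j; apply: uuC.
have [kappa [y [kam Hy]]] := ascoli_subseq T0 ysB om0 ysmod.
have zlim s : J s -> (fun k => zz (kappa k) s) @ \oo --> y s.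
  move=> Js; apply/cvg_colP => i; apply/cvgrPdist_le => e e0.
  have e2 : 0 < e / 2 by rewrite divr_gt0.
  have H1 : \forall k \near \oo, k.+1%:R^-1 <= e / 2 :> R.
    have /cvgrPdist_le/(_ _ e2) := @cvg_harmonic R; apply: filterS => k.
    by rewrite sub0r normrN; apply: le_trans; apply: ler_norm.
  have H2 : \forall k \near \oo, om k <= e / 2.
    move/cvgrPdist_le: om0 => /(_ _ e2); apply: filterS => k.
    by rewrite sub0r normrN; apply: le_trans; apply: ler_norm.
  apply: filterS (filterI H1 H2) => k [K1 K2].
  have [_ _ Hn _ zE] := Happ (kappa k); have [Jn sn] := Hn s Js.
  have -> : zz (kappa k) s i 0 = ys (kappa k) (nn (kappa k) s) i 0
    by rewrite mxE zE.
  have snk : `|s - nn (kappa k) s| <= T / k.+1%:R.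
    by apply: le_trans sn _; rewrite ler_pM2l// lef_pV2 ?posrE// ler_nat ltnS.
  have := ysmod (kappa k) k _ _ i Js Jn snk; have := Hy k s i Js.
  move: (ys _ _ _ _) (ys _ _ _ _) (y s i 0) => a b c.
  move=> /le_trans/(_ K1) + /le_trans/(_ K2).
  rewrite !ler_norml => /andP[a1 a2] /andP[b1 b2]; apply/andP; split; lra.
have yS : superposable T Bd y.
  by apply: superposable_cvg zlim => k; have [] := Happ (kappa k).
have Qlim s : J s -> (fun k =>
  Q (nn (kappa k) s) (zz (kappa k) s)) @ \oo --> Q s (y s).
  move=> Js; apply: Qc => //; last exact: zlim.
    by move=> k; have [_ _ Hn _ _] := Happ (kappa k); have [] := Hn s Js.
  apply: (@cvg_dist_invSn _ _ _ _ T) => k.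
  have [_ _ Hn _ _] := Happ (kappa k); have [_ sn] := Hn s Js.
  by apply: le_trans sn _; rewrite ler_pM2l// lef_pV2 ?posrE// ler_nat ltnS.
pose uk k := uu (kappa k).
have buk k : vbmeas T (uk k) by have [] := Happ (kappa k).
have [v [w [N0 [hullv mN0 muN0 vw]]]] :=
  @mazur_ae R T T0 m uk C buk (fun k i s _ => uuC (kappa k) s i).
have vK k s : K (v k s).
  apply: (hullv k (fun v => K (v s))) => [a b Ka Kb|j _].
    rewrite /midpoint (_ : _ *: _ = a s + 2^-1 *: (b s - a s)).
      by apply: Kcv => //; rewrite invr_ge0 ler0n/= invf_le1 ?ler1n.
    by apply/colP => l; rewrite !mxE; field.
  by have [_ _ _ H _] := Happ (kappa j); have [[]] := H s.
have vok k : vbmeas T (v k) /\ forall s j, `|v k s j 0| <= C.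
  apply: (hullv k (fun v => vbmeas T v /\ forall s j, `|v s j 0| <= C)).
    move=> a b [ba aC] [bb bC]; split; first exact/vbmeasZ/vbmeasD.
    move=> s j; rewrite !mxE normrM normfV normr_nat ler_pdivrMl//.
    by rewrite (le_trans (ler_normD _ _))// mulr_natl mulr2n lerD.
  by move=> j _; split=> // s i; apply: uuC.
pose ut k s := if s \in N0 then u0 else v k s.
pose u s := if s \in N0 then u0 else w s.
have utlim s : J s -> (fun k => ut k s) @ \oo --> u s.
  move=> Js; rewrite /ut /u; case: ifPn => [_|/negP Ns]; first exact: cvg_cst.
  by apply: vw => // /mem_set.
have butC s j : `|u0 j 0| <= C by apply: le_trans (coord_le_enorm _ _) u0C.
have but k : vbmeas T (ut k).
  move=> j; split; last first.
    by exists C => s _; rewrite /ut; case: ifP => _; [exact: butC|have [_] :=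
      vok k; apply].
  have b1 : measurable_fun J (\1_N0 : R -> R) by apply: measurable_indic.
  have [bv _] := vok k; have [mv _] := bv j.
  have mm : measurable_fun J (fun s =>
    \1_N0 s * u0 j 0 + (1 - \1_N0 s) * v k s j 0).
    apply: measurable_funD; apply: measurable_funM => //.
    by apply: measurable_funB => //; exact: measurable_cst.
  apply: eq_measurable_fun mm => s _; rewrite indicE /ut.
  by case: ifP => _; rewrite ?mul1r ?subrr ?mul0r ?addr0 ?subr0 ?mul1r ?add0r.
have buC : vbmeas T u /\ forall s j, J s -> `|u s j 0| <= C.
  have H j : bmeas T (fun s => u s j 0) /\ bounded_by T (fun s => u s j 0) C.
    apply: (@bmeas_cvg _ _ (fun k s => ut k s j 0)).
    - by move=> k; apply: but.
    - by move=> k s _; rewrite /ut; case: ifP => _; [exact: butC|have [_] :=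
      vok k; apply].
    - by move=> s Js; have /cvg_colP := utlim s Js; apply.
  by split=> [j|s j Js]; have [H1 H2] := H j => //; apply: H2.
have uK s : J s -> K (u s).
  move=> Js; rewrite /u; case: ifPn => // /negP Ns.
  have H := vw s Js (fun h => Ns (mem_set h)).
  by apply: (closed_cvg K Kcl _ _ H); apply: nearW.
exists y, u, C; split => //.
- exists N0; split => // s /= nSOL; apply: contrapT => Ns; apply: nSOL => Js.
  apply: minty => //; first exact: uK.
  move=> x Kx; apply/ler_addgt0Pr => e e0.
  (* Replacing [Q] at the node and the approximate state by its limit changes the Minty inequality
     for u_j by at most this product, as |x - u_j| <= |x| + C. From some index on the error is at
     most e for all u_j, hence also for convex combinations of the tail. *)
  have dlim : (fun k => enorm (Q (nn (kappa k) s) (zz (kappa k) s) - Q s (y s)) *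
      (enorm x + C)) @ \oo --> 0.
    rewrite -[X in _ --> X](mul0r (enorm x + C)); apply: cvgM; last exact: cvg_cst.
    rewrite -(enorm0 R m) -(subrr (Q s (y s))); apply: cvg_enorm.
    by apply: cvgB; [exact: Qlim|exact: cvg_cst].
  move/cvgrPdist_le: dlim => /(_ e e0) [j0 _ Hj0].
  have Hv k : (j0 <= k)%N -> - e <= dot (Q s (y s) + S x) (x - v k s).
    move=> j0k; apply: (hullv k (fun v => - e <= dot (Q s (y s) + S x) (x - v s))).
      move=> a b Ha Hb; rewrite /midpoint.
      have -> : x - 2^-1 *: (a s + b s) = 2^-1 *: ((x - a s) + (x - b s)).
        by apply/colP => l; rewrite !mxE; field.
      rewrite dotZr dotDr; lra.
    move=> j kj; have [_ _ _ Hs _] := Happ (kappa j); have [Hsol ubC] := Hs s.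
    have := monotone_minty Smon Hsol Kx.
    have := Hj0 j (leq_trans j0k kj); rewrite /= sub0r normrN.
    move=> /(le_trans (ler_norm _)).
    have CS := cauchy_schwarz (Q (nn (kappa j) s) (zz (kappa j) s) - Q s (y s))
      (x - uk j s).
    have : enorm (x - uk j s) <= enorm x + C.
      by apply: le_trans (enormD _ _) _; rewrite enormN lerD2l.
    move=> /(ler_wpM2l (enorm_ge0 (Q (nn (kappa j) s) (zz (kappa j) s) - Q s
      (y s)))).
    rewrite /uk in CS *; move: CS; rewrite dotBl !dotDl; lra.
  have H : (fun k => dot (Q s (y s) + S x) (x - v k s)) @ \oo -->
      dot (Q s (y s) + S x) (x - u s).
    apply: cvg_dot; first exact: cvg_cst.
    apply: cvgB; first exact: cvg_cst.
    by rewrite /u memNset//; apply: vw.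
  have : - e <= dot (Q s (y s) + S x) (x - u s).
    by apply: (ler_cvg_to (cvg_cst (- e)) H); exists j0 => // k; apply: Hv.
  lra.
- move=> t i Jt; have [bu uC] := buC.
  pose Psi (a : R -> 'cV[R]_m) := intJ T (fun s => W t i s (y s) (a s)).
  have Wb a : vbmeas T a -> bmeas T (fun s => W t i s (y s) (a s)).
    by move=> ba; apply: W_bmeas.
  apply/eqP; rewrite -subr_eq0 -normr_le0; apply/ler_addgt0Pr => e e0;
    rewrite add0r.
  have e2 : 0 < e / 2 by rewrite divr_gt0.
  (* Only the state changes between the two terms; the common control is bounded, so the difference
     tends to 0 although the controls need not converge. *)
  have dlim : (fun k => intJ T (fun s =>
      W t i s (zz (kappa k) s) (uk k s) - W t i s (y s) (uk k s))) @ \oo --> 0.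
    rewrite -[X in _ --> X](mul0r T) -(intJ_cst T0).
    apply: (@intJ_cvg _ _ T0 _ _ (WM + WM)).
    + by move=> k; apply: bmeasB; [exact: Wok|exact: Wb].
    + move=> k s Js; apply: le_trans (ler_normB _ _) _.
      by apply: lerD; apply: W_bound => // j; apply: uuC.
    + apply: aeW => s Js.
      rewrite (_ : (fun k => _) = fun k => kk T r cG t s *
         (f s (zz (kappa k) s) i 0 - f s (y s) i 0 +
           \sum_j (g s (zz (kappa k) s) i j - g s (y s) i j) * uk k s j 0) +
         t / T * (c2 s (zz (kappa k) s) i 0 - c2 s (y s) i 0) +
         (1 - t / T) * (c1 s (zz (kappa k) s) i 0 - c1 s (y s) i 0)); last first.
        apply/funext => k; rewrite /integrand !mxE.
        under [X in _ = _ * (_ + X) + _ + _]eq_bigr do rewrite mulrBl.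
        by rewrite sumrB; ring.
      have lim phi : caratheodory T Bd phi ->
          (fun k => phi s (zz (kappa k) s) - phi s (y s)) @ \oo --> 0.
        move=> [_ _ phic]; rewrite -(subrr (phi s (y s))).
        by apply: cvgB; [apply: phic => //; exact: zlim|exact: cvg_cst].
      have lim0 (a : R) (x : nat -> R) : x @ \oo --> 0 -> (fun k =>
        a * x k) @ \oo --> 0.
        by move=> x0; rewrite -[X in _ --> X](mulr0 a); apply: cvgM => //;
          exact: cvg_cst.
      have lim0D (x x' : nat -> R) : x @ \oo --> 0 -> x' @ \oo --> 0 ->
          (fun k => x k + x' k) @ \oo --> 0.
        by move=> x0 x'0; rewrite -[X in _ --> X]addr0; apply: cvgD.
      apply: (lim0D); first apply: (lim0D).
      * apply: (lim0); apply: (lim0D); first exact: (lim _ (fC i)).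
        rewrite [X in _ --> X](_ : 0 = \sum_(j < m) (0 : R)); last by rewrite big1.
        apply: cvg_big => [|j _]; first exact: add_continuous.
        have H := lim _ (gC i j); apply/cvgrPdist_le => d d0.
        have dC : 0 < d / (C + 1) by rewrite divr_gt0// ltr_wpDl.
        move/cvgrPdist_le: H => /(_ _ dC); apply: filterS => k.
        rewrite !sub0r !normrN normrM ler_pdivlMr ?ltr_wpDl// => H.
        apply: le_trans H; rewrite ler_wpM2l//.
        by apply: le_trans (uuC (kappa k) s j) _; rewrite lerDl.
      * by apply: (lim0); exact: (lim _ (c2C i)).
      * by apply: (lim0); exact: (lim _ (c1C i)).
    + exact: bmeas_cst.
  have [j0 Hj0] : exists j0, forall j, (j0 <= j)%N -> `|y t i 0 - Psi (uk j)| <= e.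
    have ylim : (fun k => ys (kappa k) t i 0) @ \oo --> y t i 0.
      by apply: (@cvg_dist_invSn _ _ _ _ 1) => k; rewrite mul1r; apply: Hy.
    move/cvgrPdist_le: dlim => /(_ _ e2) H1; move/cvgrPdist_le: ylim =>
      /(_ _ e2) H2.
    have [j0 _ H] := filterI H1 H2; exists j0 => j j0j.
    have [] := H j j0j; rewrite intJB//; [|exact: Wok|exact: Wb].
    rewrite mxE -/(Psi _) sub0r normrN.
    move: (intJ _ _) (Psi _) (y t i 0) => a b c.
    rewrite !ler_norml => /andP[a1 a2] /andP[b1 b2]; apply/andP; split; lra.
  have Hv k : (j0 <= k)%N -> vbmeas T (v k) /\ `|y t i 0 - Psi (v k)| <= e.
    move=> j0k; apply: (hullv k (fun v => vbmeas T v /\ `|y t i 0 - Psi v| <= e)).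
      move=> a b [ba Ha] [bb Hb]; have bm : vbmeas T (midpoint a b)
        by exact/vbmeasZ/vbmeasD.
      split=> //.
      have -> : Psi (midpoint a b) = 2^-1 * (Psi a + Psi b).
        have bab := bmeasD (Wb a ba) (Wb b bb).
        rewrite /Psi -(intJD T0 (Wb a ba) (Wb b bb)) -(intJZ T0 2^-1 bab).
        apply: eq_intJ => s _; rewrite /integrand /midpoint -scalemxAr mulmxDr !mxE.
        by field; rewrite gt_eqF.
      move: Ha Hb; move: (Psi a) (Psi b) (y t i 0) => pa pb c.
      rewrite !ler_norml => /andP[a1 a2] /andP[b1 b2]; apply/andP; split; lra.
    by move=> j kj; split=> //; apply: Hj0; apply: leq_trans kj.
  have Psilim : (fun k => Psi (v k)) @ \oo --> Psi u.
    apply: (@intJ_cvg _ _ T0 _ _ WM).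
    + by move=> k; apply: Wb; have [] := vok k.
    + by move=> k s Js; apply: W_bound => // j; have [_] := vok k; apply.
    + exists N0; split => // s /= nH; apply: contrapT => Ns; apply: nH => Js.
      apply: W_cvg => //.
        exact: cvg_cst.
      by rewrite /u memNset//; apply: vw.
    + exact: Wb.
  have H : (fun k => `|y t i 0 - Psi (v k)|) @ \oo --> `|y t i 0 - Psi u|.
    by apply: cvg_norm; apply: cvgB => //; exact: cvg_cst.
  apply: (ler_cvg_to H (cvg_cst e)); exists j0 => // k j0k.
  by have [_] := Hv k j0k.
Qed.

Lemma solution_continuous (y : R -> 'cV[R]_n) (u : R -> 'cV[R]_m) (C : R) :
  vbmeas T u -> 0 <= C -> (forall s j, J s -> `|u s j 0| <= C) ->
  superposable T Bd y ->
  (forall t i, J t -> y t i 0 = intJ T (fun s => W t i s (y s) (u s))) ->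
  {within J, continuous y}.
Proof.
move=> bu C0 uC yS yE; apply/subspace_continuousP => t Jt.
apply/cvg_colP => i; apply/cvgrPdist_le => e e0.
pose mA := modA m cG Bd C; pose mB := modB m T r cG Bd C.
have hm0 : 0 <= hmax m Bd C by apply: hmax_ge0.
have mA0 : 0 <= mA by apply: mulr_ge0.
have mB0 : 0 <= mB.
  apply: addr_ge0; apply: divr_ge0; rewrite ?(ltW T0)//; last exact: mulr_ge0.
  by apply: mulr_ge0 => //; apply: mulr_ge0 => //; apply: powR_ge0.
have eT : 0 < e / T by rewrite divr_gt0.
have /cvgrPdist_le/(_ _ eT) [N _ /(_ N (leqnn N))] := powR_modulus T0 r0 mA mB.
rewrite /= sub0r normrN => /(le_trans (ler_norm _)) HN.
have dN : 0 < T / N.+1%:R by rewrite divr_gt0.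
exists (T / N.+1%:R) => //= t' /ltW tt' Jt'.
rewrite !yE// -intJB//; try exact: W_bmeas.
have -> : e = e / T * T by rewrite divfK ?gt_eqF.
apply: intJ_bound => //; first by apply: bmeasB; apply: W_bmeas.
move=> s Js; apply: le_trans (W_mod t t' i (y s) Js C0 (fun j => uC s j Js)) _.
by apply: le_trans HN; rewrite lerD// ler_wpM2l// powR_incr.
Qed.

End existence.


(** * Regularity of the data of the problem *)

Section data_regularity.
Variables (R : realType) (n : nat) (T : R).
Local Notation J := (`[0, T]%classic : set R).

Lemma within_cvg_seq (V : topologicalType) (G : R -> 'cV[R]_n -> V)
    (ts : nat -> R) t (zs : nat -> 'cV[R]_n) z :
  {within J `*` setT, continuous (fun x : R * 'cV[R]_n => G x.1 x.2)} ->
  (forall k, J (ts k)) -> J t -> ts @ \oo --> t -> zs @ \oo --> z ->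
  (fun k => G (ts k) (zs k)) @ \oo --> G t z.
Proof.
move=> /subspace_continuousP Gc Jts Jt tst zsz B nB.
have H : (fun k => (ts k, zs k)) @ \oo --> (t, z).
  exact: (@cvg_pair _ _ _ _ _ _ _ (nbhs_filter t) (nbhs_filter z) _ _ tst zsz).
have [k0 _ Hk] := H _ (Gc (t, z) (conj Jt I) B nB).
by exists k0 => // k kk0; have := Hk k kk0; apply; split; first exact: Jts.
Qed.

Lemma within_cvg_time (V : topologicalType) (G : R -> 'cV[R]_n -> V) z :
  {within J `*` setT, continuous (fun x : R * 'cV[R]_n => G x.1 x.2)} ->
  {within J, continuous (fun t => G t z)}.
Proof.
move=> /subspace_continuousP Gc; apply/subspace_continuousP => t Jt B nB.
have H : (fun s => (s, z)) @ nbhs t --> (t, z).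
  exact: (@cvg_pair _ _ _ _ _ _ (nbhs_filter t) (nbhs_filter t) (nbhs_filter z) _ _
    cvg_id (@cst_continuous _ _ z t)).
apply: (@filterS _ _ (nbhs_filter t) _ _ _ (H _ (Gc (t, z) (conj Jt I) B nB))).
by move=> s Hs Js; apply: Hs; split.
Qed.

Lemma caratheodory_entry (p q : nat) (G : R -> 'cV[R]_n -> 'M[R]_(p, q)) (Bd : R)
    (i : 'I_p) (j : 'I_q) :
  {within J `*` setT, continuous (fun x : R * 'cV[R]_n => G x.1 x.2)} ->
  (forall t z, J t -> `|G t z i j| <= Bd) ->
  caratheodory T Bd (fun t z => G t z i j).
Proof.
move=> Gc GB; split => [z|//|t zs z Jt zsz].
  apply: subspace_continuous_measurable_fun; first exact: measurable_itv.
  have /subspace_continuousP H := @within_cvg_time _ _ z Gc.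
  apply/subspace_continuousP => t Jt.
  exact: (cvg_comp _ _ (H t Jt) (@coord_continuous R p q i j (G t z))).
have H : (fun k => G t (zs k)) @ \oo --> G t z.
  by apply: (@within_cvg_seq _ _ (fun=> t)) => //; apply: cvg_cst.
exact: (cvg_comp _ _ H (@coord_continuous R p q i j (G t z))).
Qed.

(** Compatibility is applied to the j-th unit vector, whose image is the j-th column. *)
Lemma entry_le_mxnorm (m : nat) (N : 'M[R]_(n, m) -> R) (A : 'M[R]_(n, m)) i j :
  compatible_mxnorm N -> `|A i j| <= N A.
Proof.
move=> [_ _ _ NA]; have := NA A (delta_mx j 0); rewrite -colE.
have -> : enorm (delta_mx j 0 : 'cV[R]_m) = 1.
  rewrite /enorm /dot (bigD1 j)//= mxE !eqxx mulr1 big1 ?addr0 ?sqrtr1// => l lj.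
  by rewrite mxE (negbTE lj) mul0r.
rewrite mulr1; apply: le_trans.
by have := coord_le_enorm (col j A) i; rewrite mxE.
Qed.

End data_regularity.

(** * Return to the mild formulation and conclusion *)

Section mild_form.
Variables (R : realType) (n m : nat) (T r cG Bd : R).
Variables (f : R -> 'cV[R]_n -> 'cV[R]_n) (g : R -> 'cV[R]_n -> 'M[R]_(n, m)).
Variables (c1 c2 : R -> 'cV[R]_n -> 'cV[R]_n).
Hypotheses (T0 : 0 < T) (r0 : 0 < r).
Local Notation mu := (@lebesgue_measure R).
Local Notation J := (`[0, T]%classic : set R).
Hypotheses (fC : forall i, caratheodory T Bd (fun t z => f t z i 0))
  (gC : forall i j, caratheodory T Bd (fun t z => g t z i j))
  (c1C : forall i, caratheodory T Bd (fun t z => c1 t z i 0))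
  (c2C : forall i, caratheodory T Bd (fun t z => c2 t z i 0)).

Lemma int_kap t (h : R -> R) : J t ->
  \int[mu]_(s in `[0, t]) ((t - s) `^ r * h s) = intJ T (fun s => kap r t s * h s).
Proof.
rewrite /= in_itv /= => /andP[t0 tT].
rewrite /intJ [LHS]Rintegral_mkcond [RHS]Rintegral_mkcond.
apply: eq_Rintegral => s _; rewrite !patchE !mem_setE !in_itv /=.
have [s0|] := leP 0 s => //=; have [st|ts] := leP s t.
  by rewrite (le_trans st tT) kap_in.
by case: ifP => // _; rewrite kap_out ?mul0r// ltW.
Qed.

Lemma integrand_split t (y : R -> 'cV[R]_n) (u : R -> 'cV[R]_m) i : J t ->
  superposable T Bd y -> vbmeas T u ->
  let h s := f s (y s) + g s (y s) *m u s in
  let I t := vintegral `[0, t] (fun s => (t - s) `^ r *: h s) in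
  intJ T (fun s => integrand T r cG f g c1 c2 t i s (y s) (u s)) =
  (cG *: I t - (t / T * cG) *: I T
    + (t / T) *: vintegral `[0, T] (fun s => c2 s (y s))
    + (1 - t / T) *: vintegral `[0, T] (fun s => c1 s (y s))) i 0.
Proof.
move=> Jt yS bu h I.
have sb phi := @superposable_bmeas R n T Bd y phi yS.
have bh : bmeas T (fun s => h s i 0).
  apply: (@bmeas_eq _ _ (fun s => f s (y s) i 0 + \sum_j g s (y s) i j * u s j 0)).
    by move=> s _; rewrite /h !mxE.
  apply: bmeasD; first exact: (sb _ (fC i)).
  by apply: bmeas_sum => j; apply: bmeasM; [exact: (sb _ (gC i j))|exact: bu].
have bk t' : J t' -> bmeas T (fun s => kap r t' s * h s i 0).
  move=> Jt'; apply: bmeasM => //; split; first exact: kap_measurable.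
  by exists (T `^ r) => s Js; apply: kap_bound.
have JT' : J T := JT T0.
have IE t' : J t' -> I t' i 0 = intJ T (fun s => kap r t' s * h s i 0).
  move=> Jt'; rewrite mxE -int_kap//; apply: eq_Rintegral => s _.
  by rewrite mxE.
have b1 : bmeas T (fun s => c1 s (y s) i 0) := sb _ (c1C i).
have b2 : bmeas T (fun s => c2 s (y s) i 0) := sb _ (c2C i).
have E (k1 k2 k3 k4 : R) (a b c d : 'cV[R]_n) :
    (k1 *: a - k2 *: b + k3 *: c + k4 *: d) i 0 =
    k1 * a i 0 - k2 * b i 0 + k3 * c i 0 + k4 * d i 0 by rewrite !mxE.
rewrite [RHS]E [X in cG * X](IE t Jt) [X in _ - _ * X](IE T JT').
have -> : vintegral J (fun s => c2 s (y s)) i 0 = intJ T (fun s => c2 s (y s) i 0).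
  by rewrite mxE.
have -> : vintegral J (fun s => c1 s (y s)) i 0 = intJ T (fun s => c1 s (y s) i 0).
  by rewrite mxE.
rewrite -(intJZ T0 cG (bk t Jt)) -(intJZ T0 (t / T * cG) (bk T JT')).
rewrite -(intJZ T0 (t / T) b2) -(intJZ T0 (1 - t / T) b1).
have bt := bmeasZ cG (bk t Jt); have bT := bmeasZ (t / T * cG) (bk T JT').
rewrite -(intJB T0 bt bT) -(intJD T0 (bmeasB bt bT) (bmeasZ (t / T) b2)).
rewrite -(intJD T0 (bmeasD (bmeasB bt bT) (bmeasZ (t / T) b2)) (bmeasZ (1 - t
  / T) b1)).
apply: eq_intJ => s _; rewrite /integrand /kk /h !mxE; ring.
Qed.

End mild_form.

Theorem theorem3p1 (R : realType) (n m : nat) (T q alpha : R)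
    (mxnorm : 'M[R]_(n, m) -> R)
    (K : set 'cV[R]_m) (F : R -> 'cV[R]_n -> fuzzy R n)
    (g : R -> 'cV[R]_n -> 'M[R]_(n, m)) (Q : R -> 'cV[R]_n -> 'cV[R]_m)
    (S : 'cV[R]_m -> 'cV[R]_m) (c1 c2 : R -> 'cV[R]_n -> 'cV[R]_n)
    (L_F eta_g eta_Q M1 M2 : R) (p : R -> R) :
  0 < T -> 1 < q <= 2 -> 0 <= alpha <= 1 ->
  compatible_mxnorm mxnorm ->
  K !=set0 -> closed K -> convex_set K ->
  (forall t z, t \in `[0, T] -> En (F t z)) ->
  {within `[0, T] `*` setT, continuous (fun x : R * 'cV[R]_n => g x.1 x.2)} ->
  {within `[0, T] `*` setT, continuous (fun x : R * 'cV[R]_n => Q x.1 x.2)} ->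
  continuous S ->
  {within `[0, T] `*` setT, continuous (fun x : R * 'cV[R]_n => c1 x.1 x.2)} ->
  {within `[0, T] `*` setT, continuous (fun x : R * 'cV[R]_n => c2 x.1 x.2)} ->
  (* A1 *)
  0 < L_F ->
  (forall t z1 z2, t \in `[0, T] ->
     (fuzzy_dist (F t z1) (F t z2) <= (L_F * enorm (z1 - z2))%:E)%E) ->
  (* A2 *)
  (forall z, strongly_measurable `[0, T] (fun t => F t z)) ->
  (* A3 *)
  p \_ `[0, T] \in Lfun (@lebesgue_measure R) +oo%E ->
  (forall t, t \in `[0, T] -> 0 <= p t) ->
  (forall z, {ae @lebesgue_measure R, forall t, t \in `[0, T] ->
     (fuzzy_norm (F t z) <= (p t)%:E)%E}) ->
  (* A4 *)
  0 < eta_g -> (forall t z, t \in `[0, T] -> mxnorm (g t z) <= eta_g) ->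
  (* A5 *)
  0 < eta_Q -> (forall t z, t \in `[0, T] -> enorm (Q t z) <= eta_Q) ->
  (* A6 *)
  monotone_on K S ->
  (exists2 u0, K u0 &
     (0 < limf_einf (fun u => (dot (S u) (u - u0) / enorm u ^+ 2)%:E)
            (at_infty_in K))%E) ->
  (* A7 *)
  0 < M1 -> (forall t z, t \in `[0, T] -> enorm (c1 t z) <= M1) ->
  0 < M2 -> (forall t z, t \in `[0, T] -> enorm (c2 t z) <= M2) ->
  (* A8 *)
  (2 * L_F * T `^ q) / Gamma (q + 1) < 1 ->
  exists (y : R -> 'cV[R]_n) (u : R -> 'cV[R]_m),
    mild_solution T q alpha K F g Q S c1 c2 y u.
Proof.
move=> T0 /andP[q1 q2] a01 Nc Kne Kcl Kcv FEn gc Qc Sc c1c c2c _ FL Fm pL p0 FP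
  _ gB _ QB Smon [u0 Ku0 Scoer] M10 c1B M20 c2B _.
pose J : set R := `[0, T]%classic.
pose r := q - 1.
have r0 : 0 < r by rewrite subr_gt0.
have r1 : r <= 1 by rewrite /r; lra.
have [P HP] := Lfun_oo_bound pL.
have [|||||z|f [N [[mN N0] fsel fm fB fcvg]]] :=
    @caratheodory_selection R n T (fun t z => level (F t z) alpha) L_F P.
- by move=> t z Jt; apply: level_nonempty (FEn t z Jt) a01.
- by move=> t z Jt; apply: level_closed (FEn t z Jt) a01.
- by move=> t z Jt; apply: level_convex (FEn t z Jt) a01.
- move=> t z1 z2 Jt; apply: le_trans (FL t z1 z2 Jt).
  exact: hausdorff_level.
- by move=> z; apply: Fm.
- apply: (@filterS2 _ _ (ae_filter_ringOfSetsType (@lebesgue_measure R))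
    _ _ _ _ HP (FP z)) => t pP Fp Jt x Fx.
  exact: le_trans (level_norm_le a01 (Fp Jt) Fx) (pP Jt).
(* A single bound for the entries of all four data; absolute values are taken because the sign of
   [P] is unknown. *)
pose Bd := `|P| + `|eta_g| + M1 + M2.
have PBd : `|P| <= Bd by rewrite /Bd; have := normr_ge0 eta_g; lra.
have gBd : eta_g <= Bd.
  by rewrite /Bd; have := normr_ge0 P; have := ler_norm eta_g; lra.
have c1Bd : M1 <= Bd.
  by rewrite /Bd; have := normr_ge0 P; have := normr_ge0 eta_g; lra.
have c2Bd : M2 <= Bd.
  by rewrite /Bd; have := normr_ge0 P; have := normr_ge0 eta_g; lra.
have Bd0 : 0 <= Bd by apply: le_trans PBd.
have fC i : caratheodory T Bd (fun t z => f t z i 0).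
  split=> [z|t z Jt|t zs z Jt zsz]; first exact: fm.
    by apply: le_trans (fB t z i Jt) PBd.
  by have /cvg_colP := fcvg t zs z Jt zsz; apply.
have gC i j : caratheodory T Bd (fun t z => g t z i j).
  apply: caratheodory_entry gc _ => t z Jt.
  exact: le_trans (entry_le_mxnorm (g t z) i j Nc) (le_trans (gB t z Jt) gBd).
have c1C i : caratheodory T Bd (fun t z => c1 t z i 0).
  apply: caratheodory_entry c1c _ => t z Jt.
  exact: le_trans (coord_le_enorm _ i) (le_trans (c1B t z Jt) c1Bd).
have c2C i : caratheodory T Bd (fun t z => c2 t z i 0).
  apply: caratheodory_entry c2c _ => t z Jt.
  exact: le_trans (coord_le_enorm _ i) (le_trans (c2B t z Jt) c2Bd).
have [y [u [C [uK [bu uC] yS uSOL yE]]]] := @limit_solution R n m T r (Gamma q)^-1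
  Bd eta_Q f g c1 c2 Q S K u0 T0 r0 r1 Bd0 fC gC c1C c2C Kcl (convex_set_cV Kcv)
  Ku0 Sc Smon Scoer (fun ts t zs z => within_cvg_seq Qc) QB.
exists y, u; split => //.
- apply: (@solution_continuous R n m T r (Gamma q)^-1 Bd f g c1 c2 T0 r0 r1 Bd0
    fC gC c1C c2C y u `|C|) => // s j Js.
  exact: le_trans (uC s j Js) (ler_norm C).
- by move=> i; apply: bmeas_integrable.
exists (fun t => f t (y t)); split.
- by move=> i; apply: bmeas_integrable => //; apply: (superposable_bmeas yS (fC i)).
(* Since [N] does not depend on z, membership can be used at z = y(t). *)
- exists N; split => // t /= nlev; apply: contrapT => Nt; apply: nlev => Jt.
  exact: fsel.
move=> h I t Jt; apply/colP => i; rewrite yE//.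
have := @integrand_split R n m T r (Gamma q)^-1 Bd f g c1 c2 T0 r0
  fC gC c1C c2C t y u i Jt yS bu.
rewrite /= => ->.
suff -> : t / (Gamma q * T) = t / T * (Gamma q)^-1 by [].
by rewrite invfM; ring.
Qed.
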